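(* Let $P=B\cup R$ be a finite point set in the plane in general position, where $B$ is a set of $b$ blue points, $R$ is a set of $r$ red points, $B\cap R=\emptyset$, $b\ge r$, and $b+r$ is even. Then $P$ has at least $r$ balanced lines.
   Context: General position means that no three points of $P$ are collinear. Put $\delta:=(b-r)/2$, a nonnegative integer, so that $b=r+2\delta$. A line $\ell$ is balanced (with respect to $P$) if it spans (i.e. passes through) one blue point and one red point of $P$, and on each of the two open halfplanes determined by $\ell$, the number of blue points of $P$ minus the number of red points of $P$ equals $\delta$. *)

(* Defs.v *)
From mathcomp Require Import all_boot all_order all_algebra finmap.
From mathcomp Require Import boolp classical_sets functions cardinality reals.

Set Implicit Arguments.
Unset Strict Implicit.
Unset Printing Implicit Defensive.

Import Order.TTheory GRing.Theory Num.Theory.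

Local Open Scope classical_set_scope.
Local Open Scope ring_scope.

Definition plane (K : realType) : choiceType := (K * K)%type.

Section Plane.
Context {K : realType}.
Implicit Types (a b c : K) (l h : set (plane K)) (p q s : plane K).
Implicit Types P B R : {fset plane K}.

Definition line_of a b c : set (plane K) :=
  [set p | a * p.1 + b * p.2 = c].

Definition is_line l : Prop :=
  exists a b c, (a, b) != (0, 0) /\ l = line_of a b c.

(* Negating (a, b, c) keeps the line and exchanges its two sides, so each line
   has exactly two open halfplanes in this sense. *)
Definition open_halfplane_of l h : Prop :=
  exists a b c, [/\ (a, b) != (0, 0), l = line_of a b c &
                    h = [set p | a * p.1 + b * p.2 < c]].

Definition collinear p q s : Prop :=
  exists l, [/\ is_line l, l p, l q & l s].

Definition general_position P : Prop :=
  forall p q s, p \in P -> q \in P -> s \in P ->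
    p != q -> p != s -> q != s -> ~ collinear p q s.

Definition count_in P h : nat := #|` [fset p in P | p \in h]%fset|.

Definition delta B R : nat := (#|` B| - #|` R|)./2.

Definition balanced B R l : Prop :=
  [/\ is_line l,
      exists2 p, p \in B & l p,
      exists2 q, q \in R & l q &
      forall h, open_halfplane_of l h ->
        (count_in B h)%:Z - (count_in R h)%:Z = (delta B R)%:Z].

End Plane.

(* Main.v *)
Require Import Defs.
From mathcomp Require Import all_boot all_order all_algebra all_fingroup finmap.
From mathcomp Require Import boolp classical_sets functions cardinality reals.
From mathcomp Require Import zify ring.

(** Why the theorem is true.  Let r be the number of red points and d half of
    the excess of the blue ones.  Sweep the plane by a rotating direction: at
    each time the points are linearly ordered, consecutive orders differ by the
    exchange of two neighbours, and half a turn reverses the order.  Read a blue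
    point as +1 and a red one as -1, and start the partial sums at -d, so that
    they end at d.  A balanced line is an exchange of a blue and a red neighbour
    that stand between two partial sums equal to 0: it moves the partial sum
    between them from 1 to -1 or back, and no other exchange changes the sign of
    an odd partial sum.  After d + 2q - 1 points the partial sum is odd, and it
    is positive exactly when fewer than q of these points are red; this gives
    the q-th sign, for q from 0 to r + 1.  The first sign is always negative and
    the last one positive, each exchange changes at most one sign, and half a
    turn reverses the string of signs and negates it.  It remains to find r sign
    changes in half a turn, or 2r in a full one.

    A wall is a pair of different consecutive signs, with indices q and q + 1.
    The partial sum between them is 0, so that q red and d + q blue points stand
    before the wall.  The two points next to a rising wall (from negative to
    positive) are blue and those next to a falling wall are red: as long as a
    rising wall stays in place the set of red points before it is constant, and
    as long as a falling wall stays in place the set of blue points before it is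
    constant.  When a sign changes, one of the walls moves across it, or two
    walls, one rising and one falling, appear or vanish together.

    Hence the walls draw closed curves in space-time, which are oriented by
    going forward in time along rising walls and backward along falling ones
    ([flow]).  Every moment sees an odd number of walls, and the number of walls
    on a given curve has a constant parity, so that some curve is mapped to
    itself by the half turn ([anti_invariant_orbit]).  It contains a wall p and
    its antipode, and it is enough to see that the index q varies by at least r
    in total along the curve from p to its antipode, and again from there to p,
    because each sign change accounts for a variation of 1 on at most one wall
    ([sum_jump_le]).

    Suppose that the path from p to its antipode does not end at an earlier time
    than it starts.  For each moment in between, keep only the last passage of
    the path: this is a rising wall.  From one such passage to the next the set
    of red points before the wall changes at most as much as q varies along the
    path, even when the path makes a detour in between, because at a given
    moment the sets before the various walls are nested and have q elements
    ([excursion_bound]).  The set of red points before the antipode of p is the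
    complement of the one before p, so that all r red points have to change
    side.  If the path ends earlier than it starts, the same argument applies to
    falling walls and to the blue points, of which there are at least r. *)

Set Implicit Arguments.
Unset Strict Implicit.
Unset Printing Implicit Defensive.

Import Order.TTheory GRing.Theory Num.Theory.

(** * Parity and total variation *)

(** The points that f moves come in pairs. *)
Lemma odd_involution_fixpoint (T : finType) (f : T -> T) (A : {set T}) :
    {in A, involutive f} -> {in A, forall x, f x \in A} -> odd #|A| ->
  exists2 x, x \in A & f x = x.
Proof.
have [n] := ubnP #|A|; elim: n A => // n IHn A ltAn fK fA oddA.
have [A0|[x Ax]] := set_0Vmem A; first by rewrite A0 cards0 in oddA.
have [|fxNx] := eqVneq (f x) x; first by exists x.
have fxA : f x \in A :\ x by rewrite !inE fxNx fA.
have cardA : #|A| = #|A :\ x :\ f x|.+2.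
  by rewrite (cardsD1 x A) Ax (cardsD1 (f x) (A :\ x)) fxA.
have sub : {subset A :\ x :\ f x <= A} by move=> y; rewrite !inE; case/and3P.
case: (IHn (A :\ x :\ f x)).
- by move: ltAn; rewrite cardA !ltnS => /ltnW.
- by move=> y /sub; apply: fK.
- move=> y; rewrite !inE => /and3P[yNfx yNx Ay]; rewrite fA // andbT.
  apply/andP; split; first by apply: contra yNx => /eqP/(congr1 f); rewrite !fK // => ->.
  by apply: contra yNfx => /eqP <-; rewrite fK.
- by move: oddA; rewrite cardA /= negbK.
by move=> y /sub Ay fyy; exists y.
Qed.

Lemma odd_sum_card (I : finType) (A : {set I}) (F : I -> nat) :
  odd (\sum_(i in A) F i)%N = odd #|[set i in A | odd (F i)]|.
Proof.
rewrite (big_morph odd oddD (erefl _)) -sum1dep_card big_mkcondr /=.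
by rewrite (big_morph odd oddD (erefl _)); apply: eq_bigr => i _; case: (odd (F i)).
Qed.

Lemma odd_sum_changes (b : nat -> bool) n :
  odd (\sum_(q < n) (b q != b q.+1)) = (b 0 != b n).
Proof.
elim: n => [|n IHn]; first by rewrite big_ord0 eqxx.
by rewrite big_ord_recr /= oddD IHn; case: (b 0) (b n) (b n.+1) => [] [] [].
Qed.

(** Here [tau i] is the time reached after i steps of a walk, [c] the cost of the
    steps and [D] a distance between the places visited.  The cost controls the
    distance on a single forward step and between two visits at the same time;
    nothing is known of a single backward step.  Going from an earlier to a
    later time the cost still controls the distance: the last step that enters
    the final time for good goes forward, and what follows it is an excursion
    between two visits at the same time. *)
Lemma excursion_bound (D : nat -> nat -> nat) (tau : nat -> int) (c : nat -> nat) :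
    (forall i j k, D i k <= D i j + D j k) ->
    (forall i, tau i.+1 <= tau i + 1)%R ->
    (forall i j, i <= j -> tau i = tau j -> D i j <= \sum_(i <= l < j) c l) ->
    (forall i, tau i.+1 = (tau i + 1)%R -> D i i.+1 <= c i) ->
  forall i j, i <= j -> (tau i <= tau j)%R -> D i j <= \sum_(i <= l < j) c l.
Proof.
move=> triD stepT levelD upD i j; have [n] := ubnP (j - i).
elim: n j => // n IHn j ltn leij; rewrite le_eqVlt => /predU1P[|lt_ij]; first exact: levelD.
have [k [leik ltkj lt_kj max_k]] : exists k, [/\ i <= k, k < j, (tau k < tau j)%R &
    forall l, k < l -> l <= j -> ~~ (tau l < tau j)%R].
  have exP : exists k, [&& i <= k, k <= j & (tau k < tau j)%R] by exists i;
    rewrite leqnn leij lt_ij.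
  have ubP k : [&& i <= k, k <= j & (tau k < tau j)%R] -> k <= j by case/and3P.
  case: (ex_maxnP exP ubP) => k /and3P[ik kj tkj] max_k; exists k; split => //.
    by rewrite ltn_neqAle kj andbT; apply: contraTneq tkj => ->; rewrite ltxx.
  move=> l ltkl lelj; apply/negP => lt_lj; move: (max_k l).
  by rewrite (leq_trans ik (ltnW ltkl)) lelj lt_lj => /(_ isT); rewrite leqNgt ltkl.
have tk1 := max_k _ (ltnSn k) ltkj; have := stepT k => tk.
have [tkE tk1E] : (tau k.+1 = tau k + 1 /\ tau k.+1 = tau j)%R by lia.
rewrite (@big_cat_nat _ _ _ k) ?(ltnW ltkj) //= [X in _ <= _ + X]big_ltn //.
have ik : D i k <= \sum_(i <= l < k) c l by apply: IHn; lia.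
have kk := upD _ tkE; have kj := levelD _ _ ltkj tk1E.
have := triD i k j; have := triD k k.+1 j; lia.
Qed.

(** * Walls between signs, and the curves that they draw *)

Section Walls.

Local Open Scope ring_scope.

Variables (Z : finZmodType) (u h : Z) (r : nat) (s : Z -> nat -> bool).

(** Time runs in a finite abelian group Z by steps of u, and h is half a turn;
    [s t q] is the sign of index q at time t.  The pair (t, q) stands for the
    gap between the signs q and q + 1. *)
Definition wall (x : Z * nat) : bool := (x.2 <= r)%N && (s x.1 x.2 != s x.1 x.2.+1).

(** The gap on the other side of the sign next to the wall x that changes between
    the times x.1 and x.1 + e; meaningful when this change destroys the wall. *)
Definition partner (e : Z) (x : Z * nat) : nat :=
  if s x.1 x.2 != s (x.1 + e) x.2 then x.2.-1 else x.2.+1.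

(** The wall at the other end of the piece of curve that leaves x on the side of
    the time x.1 + e.  The three cases are: the wall stays in place, it vanishes
    together with its partner, it moves across the sign that changes. *)
Definition link (e : Z) (x : Z * nat) : Z * nat :=
  if wall (x.1 + e, x.2) then (x.1 + e, x.2)
  else if wall (x.1, partner e x) then (x.1, partner e x) else (x.1 + e, partner e x).

(** Following a curve: forward on rising walls ([s x.1 x.2] negative) and
    backward on falling ones. *)
Definition trace (e : Z) (x : Z * nat) : Z * nat :=
  link (if s x.1 x.2 then - e else e) x.

Definition sparse (e : Z) : Prop :=
  forall t p q, s t p != s (t + e) p -> s t q != s (t + e) q -> p = q.

Definition antipode (x : Z * nat) : Z * nat := (x.1 + h, (r - x.2)%N).

Lemma sparseN e : sparse e -> sparse (- e).
Proof.
move=> sp t p q; have := sp (t - e) p q; rewrite subrK.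
by rewrite ![s (t - e) _ == _]eq_sym.
Qed.

Hypothesis s_first : forall t, s t 0 = false.
Hypothesis s_last : forall t, s t r.+1 = true.

(** A move in time keeps the direction of the wall and can be undone by a link in
    the opposite direction of time; at a turn the two walls have opposite
    directions, and each is the link of the other in the same direction. *)
Inductive link_spec (e : Z) (x y : Z * nat) : Prop :=
| LinkMove of y.1 = x.1 + e & s y.1 y.2 = s x.1 x.2 & link (- e) y = x &
    [\/ y.2 = x.2, y.2 = x.2.+1 /\ s x.1 y.2 != s y.1 y.2 |
        x.2 = y.2.+1 /\ s x.1 x.2 != s y.1 x.2]
| LinkTurn of y.1 = x.1 & s y.1 y.2 = ~~ s x.1 x.2 & link e y = x &
    [\/ y.2 = x.2.+1 /\ s x.1 y.2 != s (x.1 + e) y.2 |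
        x.2 = y.2.+1 /\ s x.1 x.2 != s (x.1 + e) x.2].

(** With at most one sign changing, a sign that changes next to a wall becomes
    equal to the sign across the wall; whether its other gap was a wall decides
    between a turn and a move. *)
Lemma linkP e x : sparse e -> wall x -> wall (link e x) /\ link_spec e x (link e x).
Proof.
case: x => t q sp /andP[/= qr wx].
have nb b : (b != ~~ b) * (~~ b != b) by case: b.
have F i j : i != j -> (s t i == s (t + e) i) || (s t j == s (t + e) j).
  by apply: contraNT; rewrite negb_or => /andP[/sp fi /fi ->].
have [w1|/negbTE w1] := boolP (wall (t + e, q)).
  rewrite {1}/link /= w1; split=> //; rewrite /link /= w1; apply: LinkMove => //=.
  - move: w1 wx (F q q.+1); rewrite /wall /= neq_ltn ltnSn => /andP[_] + + /(_ isT).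
    by case: (s t q) (s t q.+1) (s (t + e) q) (s (t + e) q.+1) => [] [] [] [].
  - by rewrite /link /= addrK /wall /= qr wx.
  by constructor 1.
have {}w1 : s (t + e) q = s (t + e) q.+1 by apply/eqP; move: w1; rewrite /wall /= qr => /negbFE.
have [fq|nfq] := boolP (s t q != s (t + e) q).
  case: q => [|q] /= in qr wx w1 fq *; first by rewrite !s_first in fq.
  have qr' := ltnW qr.
  have e1 : s (t + e) q.+1 = ~~ s t q.+1 by move: fq; case: (s t _) (s (t + e) _) => [] [].
  have e2 : s t q.+2 = ~~ s t q.+1 by move: wx; case: (s t _) (s t _) => [] [].
  have e0 : s (t + e) q = s t q.
    by apply/esym/eqP; move: (F q q.+1); rewrite neq_ltn ltnSn e1 => /(_ isT);
      case: (s t q.+1); rewrite orbF.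
  have [turn|move] := boolP (s t q != s t q.+1).
    have -> : link e (t, q.+1) = (t, q).
      by rewrite /link /wall /partner /= fq -w1 eqxx qr qr' /= turn.
    split; first by rewrite /wall /= qr'.
    apply: LinkTurn => //=; [by move: turn; case: (s t _) (s t _) => [] [] | | by constructor 2].
    have tE : s t q = ~~ s t q.+1 by move: turn; case: (s t _) (s t _) => [] [].
    by rewrite /link /wall /partner /= e0 e1 tE !eqxx andbF qr /= e2; case: (s t q.+1).
  move: move; rewrite negbK => /eqP move.
  have -> : link e (t, q.+1) = (t + e, q).
    by rewrite /link /wall /partner /= fq -w1 eqxx qr move eqxx qr'.
  split; first by rewrite /wall /= qr' e0 e1 move; case: (s t q.+1).
  apply: LinkMove => //=; [by rewrite e0 | | by constructor 3; rewrite e1; case: (s t q.+1)].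
  by rewrite /link /wall /partner /= addrK e0 move !eqxx andbF /= -w1 eqxx andbF.
move: nfq; rewrite negbK => /eqP nfq.
have f1 : s (t + e) q.+1 = ~~ s t q.+1 by move: wx; rewrite -w1 -nfq;
  case: (s t _) (s t _) => [] [].
have ltqr : (q < r)%N.
  by rewrite ltn_neqAle qr andbT; apply: contra_eqN f1 => /eqP ->; rewrite !s_last.
have e2 : s (t + e) q.+2 = s t q.+2.
  by apply/esym/eqP; move: (F q.+1 q.+2); rewrite neq_ltn ltnSn f1 => /(_ isT); case: (s t q.+1).
have e0 : s t q = ~~ s t q.+1 by rewrite nfq w1.
have [turn|move] := boolP (s t q.+1 != s t q.+2).
  have -> : link e (t, q) = (t, q.+1).
    by rewrite /link /wall /partner /= -w1 -nfq !eqxx qr /= ltqr turn.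
  split; first by rewrite /wall /= ltqr.
  apply: LinkTurn => //=; [by rewrite e0 negbK | | by constructor 1; rewrite f1 nb].
  have tE : s t q.+2 = ~~ s t q.+1 by move: turn; case: (s t _) (s t _) => [] [].
  by rewrite /link /wall /partner /= f1 e2 tE eqxx andbF nb qr e0 nb.
move: move; rewrite negbK => /eqP move.
have -> : link e (t, q) = (t + e, q.+1).
  by rewrite /link /wall /partner /= -w1 -nfq !eqxx qr /= move eqxx andbF.
split; first by rewrite /wall /= ltqr e2 f1 move; case: (s t _).
apply: LinkMove => //=; [by rewrite f1 e0 | | by constructor 2; rewrite f1; case: (s t _)].
by rewrite /link /wall /partner /= addrK -move eqxx andbF f1 nb w1 f1 eqxx andbF.
Qed.

Lemma traceP e x : sparse e -> wall x ->
  wall (trace e x) /\ link_spec (if s x.1 x.2 then - e else e) x (trace e x).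
Proof.
by move=> sp wx; apply: linkP => //; case: ifP => // _; apply: sparseN.
Qed.

(** A turn exchanges rising and falling walls and thereby reverses the direction
    of time in which the curve goes on, so that reversing the time retraces the
    curve. *)
Lemma traceK e x : sparse e -> wall x -> trace (- e) (trace e x) = x.
Proof.
move=> sp wx; have [_] := traceP sp wx; set y := trace e x => -[_ sy yx _|_ sy yx _].
  by rewrite /trace sy; move: yx; case: ifP.
by rewrite /trace sy; move: yx; case: ifP => //=; rewrite opprK.
Qed.

Hypothesis s_anti : forall t q, (q <= r.+1)%N -> s (t + h) q = ~~ s t (r.+1 - q)%N.
Hypothesis hh : h + h = 0.

Let subS_sub q : (q <= r)%N -> (r.+1 - (r - q))%N = q.+1.
Proof. lia. Qed.

Lemma s_antipode x : wall x -> s (antipode x).1 (antipode x).2 = s x.1 x.2.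
Proof.
move=> /andP[xr wx]; rewrite s_anti /=; last by rewrite leqW ?leq_subr.
rewrite subS_sub //.
by move: wx; case: (s _ _) (s _ _) => [] [].
Qed.

Lemma wall_antipode x : (x.2 <= r)%N -> wall (antipode x) = wall x.
Proof.
move=> xr; rewrite /wall /= leq_subr xr !s_anti; last 2 first.
- by rewrite ltnS leq_subr.
- by rewrite leqW ?leq_subr.
rewrite subSS subKn // subS_sub //.
by case: (s _ _) (s _ _) => [] [].
Qed.

Lemma antipodeK x : (x.2 <= r)%N -> antipode (antipode x) = x.
Proof. by case: x => t q /= qr; rewrite /antipode /= subKn // -addrA hh addr0. Qed.

(** Reversing and negating the string of signs exchanges the two signs next to a
    wall, but preserves the direction of the wall. *)
Lemma link_antipode e x : sparse e -> wall x -> link e (antipode x) = antipode (link e x).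
Proof.
case: x => t q sp wx; have /andP[/= qr wtq] := wx.
have wAP e' q' : (q' <= r)%N -> wall (t + h + e', (r - q')%N) = wall (t + e', q').
  by move=> q'r; rewrite addrAC (wall_antipode (x := (_, _))).
rewrite /link /= wAP //; have [//|w1] := ifPn; first by rewrite /antipode /= addrAC.
have f1 : (s t q != s (t + e) q) = ~~ (s t q.+1 != s (t + e) q.+1).
  move: w1 wtq; rewrite /wall /= qr /=.
  by case: (s t q) (s t q.+1) (s (t + e) q) (s (t + e) q.+1) => [] [] [] [].
have [fq|nfq] := boolP (s t q != s (t + e) q).
  case: q => [|q] in qr fq w1 wtq f1 wx *; first by rewrite !s_first in fq.
  have -> : partner e (antipode (t, q.+1)) = (r - q)%N.
    rewrite /partner /= addrAC !s_anti ?leqW ?leq_subr //.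
    rewrite subS_sub //.
    have -> : (~~ s t q.+2 != ~~ s (t + e) q.+2) = false.
      by move: f1; rewrite fq; case: (s t _) (s (t + e) _) => [] [].
    by rewrite -subSn // subSS.
  have pq : partner e (t, q.+1) = q by rewrite /partner /= fq.
  rewrite pq; have := wAP 0 q (ltnW qr); rewrite !addr0 => ->.
  by case: ifP => _; [|rewrite /antipode /= addrAC].
have f2 : s t q.+1 != s (t + e) q.+1 by move: f1; rewrite (negbTE nfq) => /esym/negbFE.
have ltqr : (q < r)%N.
  by rewrite ltn_neqAle qr andbT; apply: contraNN f2 => /eqP ->; rewrite !s_last.
have -> : partner e (antipode (t, q)) = (r - q.+1)%N.
  rewrite /partner /= addrAC !s_anti ?leqW ?leq_subr //.
  rewrite subS_sub //.
  have -> : ~~ s t q.+1 != ~~ s (t + e) q.+1.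
    by move: f2; case: (s t _) (s (t + e) _) => [] [].
  by rewrite subnS.
have pq : partner e (t, q) = q.+1 by rewrite /partner /= (negbTE nfq).
rewrite pq; have := wAP 0 q.+1 ltqr; rewrite !addr0 => ->.
by case: ifP => _; [|rewrite /antipode /= addrAC].
Qed.

Lemma trace_antipode e x : sparse e -> wall x -> trace e (antipode x) = antipode (trace e x).
Proof.
move=> sp wx; rewrite /trace s_antipode // link_antipode //.
by case: ifP => // _; apply: sparseN.
Qed.

(** Bounding the index makes the space of gaps finite; gaps that are not walls are
    left fixed, so that following the curves becomes a permutation. *)
Definition emb (x : Z * 'I_r.+1) : Z * nat := (x.1, x.2 : nat).

Definition step (e : Z) (x : Z * 'I_r.+1) : Z * 'I_r.+1 :=
  if wall (emb x) then ((trace e (emb x)).1, inord (trace e (emb x)).2) else x.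

Lemma emb_inj : injective emb.
Proof. by case=> t q [t' q'] [-> /val_inj ->]. Qed.

Lemma emb_step e x : sparse e -> wall (emb x) -> emb (step e x) = trace e (emb x).
Proof.
move=> sp wx; rewrite /step wx /emb /= inordK -?surjective_pairing // ltnS.
by case: (traceP sp wx) => /andP[].
Qed.

Lemma stepK e : sparse e -> cancel (step e) (step (- e)).
Proof.
move=> sp x; have [wx|nwx] := boolP (wall (emb x)); last by rewrite /step !(negbTE nwx).
have wy : wall (emb (step e x)) by rewrite emb_step //; case: (traceP sp wx).
apply: emb_inj; rewrite emb_step //; last exact: sparseN.
by rewrite emb_step // traceK.
Qed.

Hypothesis s_step : sparse u.
Hypothesis u_neq0 : u != 0.

Definition flow : {perm Z * 'I_r.+1} := perm (can_inj (stepK s_step)).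

Lemma flowE x : wall (emb x) -> emb (flow x) = trace u (emb x).
Proof. by move=> wx; rewrite permE emb_step. Qed.

Lemma flowVE x : wall (emb x) -> emb (flow^-1%g x) = trace (- u) (emb x).
Proof.
move=> wx; rewrite -emb_step //; last exact: sparseN.
by congr emb; apply: (@perm_inj _ flow); rewrite permKV permE;
  have := stepK (sparseN s_step) x; rewrite opprK => ->.
Qed.

Definition slot_walls (t : Z) : {set Z * 'I_r.+1} :=
  [set x | wall (emb x) && (x.1 == t)].

(** The first and the last sign differ. *)
Lemma odd_slot_walls t : odd #|slot_walls t|.
Proof.
have -> : #|slot_walls t| = (\sum_(q < r.+1) (s t q != s t q.+1))%N.
  have -> : slot_walls t = pair t @: [set q : 'I_r.+1 | s t q != s t q.+1].
    apply/setP=> -[t' q]; rewrite inE /wall /= -ltnS ltn_ord /=; apply/andP/imsetP.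
      by case=> wq /eqP tE; exists q; rewrite ?inE -?tE.
    by case=> q'; rewrite inE => wq [-> ->].
  rewrite card_imset; last by move=> q q' [].
  rewrite -sum1dep_card big_mkcond; apply: eq_bigr => q _.
  by case: (_ != _).
by rewrite odd_sum_changes s_first s_last.
Qed.

(** Between two consecutive times the links join in pairs the walls of C that
    belong to either time. *)
Lemma odd_slot_step (C : {set Z * 'I_r.+1}) t :
    (forall x, x \in C -> flow x \in C) -> (forall x, x \in C -> flow^-1%g x \in C) ->
  odd #|C :&: slot_walls (t + u)| = odd #|C :&: slot_walls t|.
Proof.
move=> Cf CfV; pose D := C :&: slot_walls t :|: C :&: slot_walls (t + u).
have disj : [disjoint C :&: slot_walls t & C :&: slot_walls (t + u)].
  rewrite -setI_eq0; apply/eqP/setP => x; rewrite !inE; apply/negP.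
  case/andP=> /and3P[_ _ /eqP ->] /and3P[_ _].
  by rewrite -{1}[t]addr0 (inj_eq (addrI t)) eq_sym (negbTE u_neq0).
have cardD : #|D| = (#|C :&: slot_walls t| + #|C :&: slot_walls (t + u)%R|)%N.
  by rewrite /D cardsU (disjoint_setI0 disj) cards0 subn0.
pose turn (x : Z * 'I_r.+1) e := if s x.1 x.2 then step (- e) x else step e x.
have turnE x e : sparse e -> wall (emb x) -> emb (turn x e) = link e (emb x).
  move=> sp wx; rewrite /turn; case: ifP => sx; last by rewrite emb_step // /trace sx.
  by rewrite emb_step // ?/trace ?sx ?opprK //; apply: sparseN.
have suN := sparseN s_step.
pose f x := turn x (if x.1 == t then u else - u).
have turnC x e : e = u \/ e = - u -> x \in C -> wall (emb x) -> turn x e \in C.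
  move=> eu Cx wx.
  have [Fx FVx] : emb (flow x) = trace u (emb x) /\ emb (flow^-1%g x) = trace (- u) (emb x).
    by rewrite flowE ?flowVE.
  have [E|E] : turn x e = flow x \/ turn x e = flow^-1%g x.
    rewrite /turn; case: eu => ->; case: ifP => _; [right|left|left|right];
    by apply: emb_inj; rewrite ?opprK emb_step // ?Fx ?FVx.
  - by rewrite E Cf.
  - by rewrite E CfV.
apply/eqP; apply: contraT => neq.
have oddD : odd #|D| by rewrite cardD oddD; move: neq; case: (odd _) (odd _) => [] [].
have Dspec x : x \in D -> [/\ x \in C, wall (emb x) & x.1 = t \/ x.1 = t + u].
  by rewrite !inE => /orP[] /and3P[-> -> /eqP]; split=> //; [left|right].
have tu : (t + u == t) = false.
  by rewrite -{2}[t]addr0 (inj_eq (addrI t)) (negbTE u_neq0).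
have DI x : x \in C -> wall (emb x) -> x.1 = t \/ x.1 = t + u -> x \in D.
  by move=> Cx wx; rewrite !inE Cx wx /= => -[] ->; rewrite eqxx ?orbT.
have fP x : x \in D -> [/\ f x \in D, f (f x) = x & f x <> x].
  case/Dspec => Cx wx xt; rewrite {2 3}/f; set e := if _ then u else - u.
  have eu : e = u \/ e = - u by rewrite /e; case: ifP; [left|right].
  have spe : sparse e by case: eu => ->.
  have Cy := turnC x e eu Cx wx; have yE := turnE x e spe wx.
  have [wy spec] := linkP spe wx; rewrite -yE in wy spec.
  have -> : f x = turn x e by [].
  case: spec => /= [y1 sy yx _|y1 sy yx _].
    have [yt ye] : ((turn x e).1 = t \/ (turn x e).1 = t + u) /\
        (if (turn x e).1 == t then u else - u) = - e.
      rewrite y1 /e; case: xt => ->; rewrite ?eqxx ?tu ?addrK ?opprK; first by split;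
        [right|rewrite ?tu].
      by rewrite eqxx; split; [left|].
    split; first exact: DI.
      by rewrite /f ye; apply: emb_inj; rewrite turnE //; apply: sparseN.
    move=> yx1; move: y1; rewrite yx1 => /eqP.
    rewrite -{1}[x.1]addr0 (inj_eq (addrI _)) eq_sym.
    by case: eu => ->; rewrite ?oppr_eq0 (negbTE u_neq0).
  split; first by apply: DI => //; rewrite y1.
    by rewrite /f y1 -/e; apply: emb_inj; rewrite turnE.
  by move=> yx1; move: sy; rewrite yx1; case: (s _ _).
case: (odd_involution_fixpoint (f := f) (A := D)) => //.
- by move=> x /fP[].
- by move=> x /fP[].
by move=> x /fP[].
Qed.

Definition anti (x : Z * 'I_r.+1) : Z * 'I_r.+1 := (x.1 + h, rev_ord x.2).

Lemma emb_anti x : emb (anti x) = antipode (emb x).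
Proof. by rewrite /emb /anti /antipode /= subSS. Qed.

Lemma leq_emb x : ((emb x).2 <= r)%N.
Proof. by rewrite -ltnS ltn_ord. Qed.

Lemma antiK : involutive anti.
Proof. by move=> x; apply: emb_inj; rewrite !emb_anti antipodeK // leq_emb. Qed.

Lemma wall_anti x : wall (emb (anti x)) = wall (emb x).
Proof. by rewrite emb_anti wall_antipode // leq_emb. Qed.

Lemma flow_anti x : flow (anti x) = anti (flow x).
Proof.
have [wx|nwx] := boolP (wall (emb x)); last first.
  by rewrite !permE /step wall_anti (negbTE nwx).
by apply: emb_inj; rewrite flowE ?wall_anti // !emb_anti flowE // trace_antipode.
Qed.

Lemma odd_slot_iter (C : {set Z * 'I_r.+1}) t N :
    (forall x, x \in C -> flow x \in C) -> (forall x, x \in C -> flow^-1%g x \in C) ->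
  odd #|C :&: slot_walls (t + u *+ N)| = odd #|C :&: slot_walls t|.
Proof.
move=> Cf CfV; elim: N => [|N IHN]; first by rewrite addr0.
by rewrite mulrSr addrA odd_slot_step.
Qed.

Lemma porbit_anti x : porbit flow (anti x) = anti @: porbit flow x.
Proof.
have iterA y k : (flow ^+ k)%g (anti y) = anti ((flow ^+ k)%g y).
  by elim: k => [|k IHk]; rewrite ?expg0 ?perm1 // !expgSr !permM IHk flow_anti.
apply/setP=> y; apply/porbitP/imsetP => [[i ->]|[z /porbitP[i ->] ->]].
  by exists ((flow ^+ i)%g x); rewrite ?mem_porbit ?iterA.
by exists i; rewrite iterA.
Qed.

(** The antipode permutes the curves with an odd number of walls at time 0, because
    this parity does not depend on the time.  There is an odd number of such
    curves, so that the involution has a fixed point. *)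
Lemma anti_invariant_orbit N : h = u *+ N ->
  exists2 p, wall (emb p) & anti p \in porbit flow p.
Proof.
move=> hN; pose S := [set O in porbits flow | odd #|O :&: slot_walls 0|].
have oddS : odd #|S|.
  rewrite -odd_sum_card.
  have <- : #|slot_walls 0| = (\sum_(O in porbits flow) #|O :&: slot_walls 0%R|)%N;
    last exact: odd_slot_walls.
  rewrite -sum1_card (partition_big (porbit flow) (mem (porbits flow))) => /= [|x _];
    last exact: imset_f.
  apply: eq_bigr => O /imsetP[x _ ->]; rewrite -sum1_card.
  apply: eq_bigl => y; rewrite [in RHS]inE andbC; congr andb.
  by rewrite eq_porbit_mem porbit_sym.
have orbitC x : (forall y, y \in porbit flow x -> flow y \in porbit flow x) /\
                (forall y, y \in porbit flow x -> flow^-1%g y \in porbit flow x).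
  split=> y; rewrite -eq_porbit_mem => /eqP <-.
    by have := mem_porbit flow 1 y; rewrite expg1.
  by have := mem_porbit flow 1 (flow^-1%g y); rewrite expg1 permKV porbit_sym.
have antiS O : O \in S -> anti @: O \in S.
  rewrite !inE => /andP[/imsetP[x _ ->] oddO]; rewrite -porbit_anti imset_f //=.
  have [Cf CfV] := orbitC x.
  rewrite -(odd_slot_iter 0 N Cf CfV) add0r -hN in oddO.
  congr (is_true (odd _)): oddO; rewrite porbit_anti -(card_imset _ (inv_inj antiK));
    congr #|pred_of_set _|.
  apply/setP=> y; rewrite inE; apply/imsetP/andP => [[z + ->]|[/imsetP[z zO ->]]].
    rewrite !inE => /and3P[zO wz /eqP zh]; split; first exact: imset_f.
    by rewrite wall_anti wz /= zh hh.
  rewrite !inE wall_anti => /andP[wz zh]; exists z => //; rewrite !inE zO wz.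
  by rewrite /= -(inj_eq (addIr h)) hh.
have [|||O SO OE] := @odd_involution_fixpoint _ (fun O : {set _} => anti @: O) S => //.
  by move=> O _; rewrite -imset_comp (eq_imset _ (_ : anti \o anti =1 id)) ?imset_id // => x;
    rewrite /= antiK.
move: SO; rewrite inE => /andP[/imsetP[x _ Ox] /odd_gt0].
rewrite card_gt0 => /set0Pn[p]; rewrite !inE => /and3P[Op wp _]; exists p => //.
move: (Op); rewrite {1}Ox -eq_porbit_mem => /eqP ->.
by rewrite -Ox -OE imset_f.
Qed.

Definition flips (t : Z) : bool := [exists q : 'I_r.+1, s t q != s (t + u) q].

Definition dist (p q : nat) : nat := (p - q + (q - p))%N.

Definition jump (x : Z * 'I_r.+1) : nat := dist x.2 (flow x).2.

(** The curve leaves the wall x within the step from [link_time x] to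
    [link_time x + u], which a falling wall traverses backward. *)
Definition link_time (x : Z * nat) : Z := if s x.1 x.2 then x.1 - u else x.1.

Lemma trace_flip x : wall x -> (trace u x).2 != x.2 ->
  exists2 k, s (link_time x) k != s (link_time x + u) k & (k == x.2) || (k == x.2.+1).
Proof.
move=> wx; have [_] := traceP s_step wx; set e := if s _ _ then _ else u => spec yx.
have [k fk kx] : exists2 k, s x.1 k != s (x.1 + e) k & (k == x.2) || (k == x.2.+1).
  case: spec => [<- _ _|_ _ _] [].
  - by move=> y2; rewrite y2 eqxx in yx.
  - by case=> y2 fl; exists x.2.+1; rewrite ?eqxx ?orbT // -y2.
  - by case=> _ fl; exists x.2; rewrite ?eqxx.
  - by case=> y2 fl; exists x.2.+1; rewrite ?eqxx ?orbT // -y2.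
  - by case=> _ fl; exists x.2; rewrite ?eqxx.
exists k => //; move: fk; rewrite /link_time /e; case: ifP => // _.
by rewrite subrK eq_sym.
Qed.

(** Each sign change is traversed once: among the four gaps next to the sign, two
    at each end of the step, only one is a wall from which the curve enters the
    step and changes its index.  The old value of the sign tells on which side
    of it this gap lies, and the sign across the gap, which does not change,
    tells at which end of the step. *)
Lemma link_time_inj x y j k : wall x -> wall y -> link_time x = link_time y ->
    s (link_time x) j != s (link_time x + u) j -> (j == x.2) || (j == x.2.+1) ->
    s (link_time y) k != s (link_time y + u) k -> (k == y.2) || (k == y.2.+1) -> x = y.
Proof.
have ends z : wall z ->
    [/\ z.1 = link_time z, s (link_time z) z.2 = false & s (link_time z) z.2.+1 = true] \/
    [/\ z.1 = link_time z + u, s (link_time z + u) z.2 = true & s (link_time z + u) z.2.+1 =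
      false].
  case: z => t p /andP[/= _ wz]; rewrite /link_time /=; case: ifP => st; rewrite ?subrK.
    by right; split=> //; move: wz; rewrite st; case: (s _ _).
  by left; split=> //; move: wz; rewrite st; case: (s _ _).
move=> wx wy xy jf jx; rewrite -xy => kf ky.
have jk := s_step kf jf; subst k.
have F i : i != j -> s (link_time x) i = s (link_time x + u) i.
  by move=> ij; apply/eqP; apply: contraNT ij => /s_step - /(_ _ jf) ->.
have := ends y wy; rewrite -xy; have := ends x wx.
move: (link_time x) F jf {xy kf} => t F jf.
have Sn n : n.+1 != n by rewrite gtn_eqF.
have nS n : n != n.+1 by rewrite ltn_eqF.
case: x y {wx wy} jx ky => [t1 p] [t2 q] /= /pred2P jp /pred2P jq.
move/eqP: jf => jf.
case: jp => jp; case: jq => jq.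
- have {jq}pq : p = q by rewrite -jp.
  by subst p j; move: (F _ (Sn q)) => E [] [? ? ?] [] [? ? ?]; congruence.
- by subst p j => -[] [? ? ?] [] [? ? ?]; congruence.
- by subst q j => -[] [? ? ?] [] [? ? ?]; congruence.
have {jq}pq : p = q by move: jq; rewrite jp => -[].
by subst p j; move: (F _ (nS q)) => E [] [? ? ?] [] [? ? ?]; congruence.
Qed.

Lemma jumpE x : wall (emb x) -> jump x = dist (emb x).2 (trace u (emb x)).2.
Proof. by move=> wx; rewrite -flowE. Qed.

Lemma jump_le1 x : wall (emb x) -> (jump x <= 1)%N.
Proof.
move=> wx; rewrite jumpE //; have [_] := traceP s_step wx; rewrite /dist.
by case=> [_ _ _|_ _ _] [] => [->|[-> _]|[-> _]|[-> _]|[-> _]]; lia.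
Qed.

Lemma sum_jump_le (A : {set Z * 'I_r.+1}) : {in A, forall x, wall (emb x)} ->
  (\sum_(x in A) jump x <= #|[set t | flips t]|)%N.
Proof.
move=> wA; pose B := [set x in A | jump x != 0%N].
have -> : (\sum_(x in A) jump x = #|B|)%N.
  rewrite -sum1dep_card big_mkcondr /=; apply: eq_bigr => x Ax.
  by move: (jump_le1 (wA x Ax)); case: (jump x) => [|[|]].
have moves x : x \in B -> wall (emb x) /\ (trace u (emb x)).2 != (emb x).2.
  rewrite inE => /andP[/wA wx jx]; split=> //; apply: contraNneq jx => E.
  by rewrite jumpE // E /dist subnn.
rewrite -(card_in_imset (f := link_time \o emb)) => [|x y /moves[wx mx] /moves[wy my] /= E].
  apply/subset_leq_card/fintype.subsetP => t /imsetP[x /moves[wx mx] ->] /=; rewrite inE.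
  have [k fk /orP kx] := trace_flip wx mx; apply/existsP.
  have kr : (k < r.+1)%N.
    have := leq_emb x; case: kx => /eqP kx; first by rewrite kx.
    rewrite leq_eqVlt => /predU1P[xr|]; last by rewrite kx.
    by rewrite kx xr !s_last in fk.
  by exists (Ordinal kr).
have [j fj jx] := trace_flip wx mx; have [k fk ky] := trace_flip wy my.
exact: emb_inj (link_time_inj wx wy E fj jx fk ky).
Qed.

(** [D] compares two walls: [D false] will count the red points, and [D true] the
    blue points, that are before exactly one of them.  A wall that
    stays in place is only controlled in the colour attached to its direction;
    this is why the two directions of time are treated by different colours. *)
Variable D : bool -> Z * nat -> Z * nat -> nat.
Hypothesis D_sym : forall c x y, D c x y = D c y x.
Hypothesis D_tri : forall c x y z, (D c x z <= D c x y + D c y z)%N.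
Hypothesis D_level : forall c t p q, wall (t, p) -> wall (t, q) ->
  (D c (t, p) (t, q) <= dist p q)%N.
Hypothesis D_stay : forall t q, wall (t, q) -> wall (t + u, q) -> s (t + u) q = s t q ->
  D (s t q) (t, q) (t + u, q) = 0%N.
Hypothesis D_up : forall c t q, wall (t, q) -> wall (t + u, q.+1) -> s t q.+1 != s (t + u) q.+1 ->
  (D c (t, q) (t + u, q.+1)%R <= 1)%N.
Hypothesis D_down : forall c t q, wall (t, q.+1) -> wall (t + u, q) ->
  s t q.+1 != s (t + u) q.+1 ->
  (D c (t, q.+1) (t + u, q)%R <= 1)%N.
Hypothesis D_antipode : forall c x, wall x -> (r <= D c x (antipode x))%N.

(** The time increments of the curve, lifted from Z to the integers. *)
Definition advance (x : Z * 'I_r.+1) : int :=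
  if (flow x).1 == x.1 then 0 else if s x.1 x.2 then -1 else 1.

Lemma slot_flow x : wall (emb x) -> (flow x).1 = x.1 + u *~ advance x.
Proof.
move=> wx; rewrite /advance -[(flow x).1]/((emb (flow x)).1) flowE //.
rewrite -[s x.1 x.2]/(s (emb x).1 (emb x).2).
have [_] := traceP s_step wx; case: ifP => sx [y1 _ _ _|y1 _ _ _].
all: have [E|nE] := eqVneq; rewrite ?E ?mulr0z ?addr0 //.
- by rewrite y1 eqxx in nE.
- by rewrite y1 eqxx in nE.
Qed.

Lemma D_flow x : wall (emb x) -> advance x != 0 ->
  (D (s x.1 x.2) (emb x) (emb (flow x)) <= jump x)%N.
Proof.
case: x => t i wx; rewrite /advance jumpE // -[(flow _).1]/((emb (flow (t, i))).1) flowE //.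
have [wy spec] := traceP s_step wx; move: wx wy spec; rewrite /emb.
case: (trace u _) => t' q; move: (nat_of_ord i) => p wx /=.
case: eqVneq => [_ _ _|tt' wy []] //= y1; last by rewrite y1 eqxx in tt'.
move=> sy _ dq _; case: ifP sy dq y1 => sx sy dq y1.
  have tE : t = t' + u by rewrite y1 subrK.
  subst t; rewrite D_sym; case: dq => [qp|[qp fl]|[pq fl]]; subst.
  - by rewrite -sy D_stay // sy sx.
  - by rewrite (leq_trans (D_down _ _ _ _)) // 1?eq_sym // /dist; lia.
  - by rewrite (leq_trans (D_up _ _ _ _)) // 1?eq_sym // /dist; lia.
subst t'; case: dq => [qp|[qp fl]|[pq fl]]; subst.
- by rewrite -sx D_stay // sy.
- by rewrite (leq_trans (D_up _ _ _ _)) // /dist; lia.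
- by rewrite (leq_trans (D_down _ _ _ _)) // /dist; lia.
Qed.

(** An invariant curve splits into a path from p to its antipode and a path back;
    [excursion_bound], used with the lifted time or with its opposite, shows
    that each of them costs at least r. *)
Theorem twice_le_flips N : h = u *+ N -> (2 * r <= #|[set t | flips t]|)%N.
Proof.
move=> hN; have [p wp] := anti_invariant_orbit hN.
rewrite porbit_traject => /trajectP[m mL pm].
set L := #|porbit flow p| in mL; pose x i := iter i flow p.
have wx i : wall (emb (x i)).
  elim: i => [|i wi]; rewrite // -[x i.+1]/(flow (x i)) flowE //.
  by case: (traceP s_step wi).
pose tau i : int := \sum_(0 <= l < i) advance (x l).
have tauS i : tau i.+1 = tau i + advance (x i) by rewrite /tau big_nat_recr.
have slotE i : (x i).1 = p.1 + u *~ tau i.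
  elim: i => [|i IHi]; first by rewrite /tau big_nil addr0.
  by rewrite tauS mulrzDr addrA -IHi -slot_flow.
have advB i : (-1 <= advance (x i) <= 1)%R.
  by rewrite /advance; case: ifP => // _; case: ifP.
have sum_dist i j : (i <= j)%N -> (dist (x i).2 (x j).2 <= \sum_(i <= l < j) jump (x l))%N.
  elim: j => [|j IHj]; first by rewrite leqn0 => /eqP ->; rewrite /dist subnn.
  rewrite leq_eqVlt => /predU1P[<-|]; first by rewrite /dist subnn.
  rewrite ltnS => ij; rewrite big_nat_recr //; move: (\sum_(i <= l < j) _)%N (IHj ij) => S.
  rewrite -[x j.+1]/(flow (x j)) /jump /dist.
  by move: (nat_of_ord (x j).2) (nat_of_ord (flow (x j)).2) => a b /=; lia.
have level c i j : (i <= j)%N -> tau i = tau j ->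
    (D c (emb (x i)) (emb (x j)) <= \sum_(i <= l < j) jump (x l))%N.
  move=> ij tij; apply: leq_trans (sum_dist i j ij).
  have E : (x i).1 = (x j).1 by rewrite !slotE tij.
  have := wx j; have := wx i; rewrite /emb E; exact: D_level.
have bound i j : (i <= j)%N ->
    exists c, (D c (emb (x i)) (emb (x j)) <= \sum_(i <= l < j) jump (x l))%N.
  move=> ij; have [tij|tij] := lerP (tau i) (tau j); [exists false|exists true].
    apply: (excursion_bound (D := fun i j => D false (emb (x i)) (emb (x j))) (tau := tau)) => //.
    - by move=> k; rewrite tauS; have := advB k; lia.
    - by move=> k l; apply: level.
    move=> k; rewrite tauS => /addrI ak; have := D_flow (wx k).
    by rewrite ak => /(_ isT); move: ak; rewrite /advance; case: ifP => // _; case: ifP.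
  apply: (excursion_bound (D := fun i j => D true (emb (x i)) (emb (x j))) (tau :=
    fun i => - tau i)) => //.
  - by move=> k; rewrite tauS; have := advB k; lia.
  - by move=> k l kl /oppr_inj; apply: level.
  - move=> k; rewrite tauS opprD => /addrI ak; have := D_flow (wx k).
    have {}ak : advance (x k) = -1 by lia.
    by rewrite ak => /(_ isT); move: ak; rewrite /advance; case: ifP => // _; case: ifP.
  by lia.
have half i j : (i <= j)%N -> x j = anti (x i) -> (r <= \sum_(i <= l < j) jump (x l))%N.
  move=> ij xE; have [c] := bound i j ij; apply: leq_trans.
  by rewrite xE emb_anti D_antipode.
have xL : x L = p by rewrite /x /L iter_porbit.
have xm : x m = anti p by rewrite pm.
apply: leq_trans (sum_jump_le (A := porbit flow p) _); last first.
  by move=> y; rewrite porbit_traject => /trajectP[i _ ->]; apply: wx.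
have -> : (\sum_(y in porbit flow p) jump y = \sum_(0 <= l < L) jump (x l))%N.
  rewrite (eq_bigl _ _ (porbit_traject flow p)) -big_uniq ?uniq_traject_porbit //=.
  rewrite (big_nth p) size_traject; apply: eq_big_nat => i /andP[_ iL].
  by rewrite nth_traject.
rewrite (big_cat_nat _ (n := m)) //=; last exact: ltnW.
rewrite mul2n -addnn leq_add //; apply: half => //; first exact: ltnW.
by rewrite xL xm antiK.
Qed.

End Walls.

(** * Walls in a sequence of orders *)

Section Sweep.

(** R is the set of red points; the step from t to t + u exchanges a t and b t. *)
Variables (V : finType) (R : {set V}) (d : nat).
Variables (Z : finZmodType) (u h : Z) (lt : Z -> rel V) (a b : Z -> V).

Local Notation r := #|R|.

Hypothesis card_V : #|V| = (d + r).*2.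
Hypothesis lt_irr : forall t, irreflexive (lt t).
Hypothesis lt_trans : forall t, transitive (lt t).
Hypothesis lt_total : forall t p q, p != q -> lt t p q || lt t q p.
Hypothesis lt_opp : forall t p q, lt (t + h)%R p q = lt t q p.
Hypothesis lt_ab : forall t, lt t (a t) (b t).
Hypothesis lt_ba : forall t, lt (t + u)%R (b t) (a t).
Hypothesis lt_swap : forall t p q, lt (t + u)%R p q != lt t p q ->
  (p, q) = (a t, b t) \/ (p, q) = (b t, a t).

Definition pos t p : nat := #|[set q | lt t q p]|.
Definition prefix t k : {set V} := [set p | pos t p < k].
Definition reds t k : nat := #|R :&: prefix t k|.
(** Among the first d + 2q - 1 points, blue exceeds red by more than d exactly
    when fewer than q of them are red.  The conventions for the first and the
    last sign come out by themselves: no number is below 0, and a prefix has at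
    most r red points; for d = 0 this also covers the truncated index at q = 0. *)
Definition sign t q : bool := reds t (d + q.*2).-1 < q.
Definition cut t : nat := (pos t (a t)).+1.

Lemma lt_asym t p q : lt t p q -> lt t q p = false.
Proof. by move=> pq; apply/negP => /(lt_trans pq); rewrite lt_irr. Qed.

Lemma ltn_pos t p q : (pos t p < pos t q) = lt t p q.
Proof.
have lt_pos x y : lt t x y -> pos t x < pos t y.
  move=> xy; apply: proper_card; apply/properP; split.
    by apply/fintype.subsetP => z; rewrite !inE => /lt_trans/(_ xy).
  by exists x; rewrite !inE ?lt_irr.
have [pq|npq] := boolP (lt t p q); first exact: lt_pos.
have [->|pq] := eqVneq p q; first by rewrite ltnn.
have := lt_total t pq; rewrite (negbTE npq) => /lt_pos qp.
by rewrite ltnNge (ltnW qp).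
Qed.

Lemma pos_inj t : injective (pos t).
Proof.
move=> p q pq; apply/eqP; apply: contraT => /(lt_total t).
by rewrite -!ltn_pos pq ltnn.
Qed.

Lemma ltn_pos_card t p : pos t p < #|V|.
Proof.
rewrite -cardsT; apply: proper_card; apply/properP; split; first exact/fintype.subsetP.
by exists p; rewrite inE ?lt_irr.
Qed.

Lemma card_prefix t k : k <= #|V| -> #|prefix t k| = k.
Proof.
move=> kV; pose f p := Ordinal (ltn_pos_card t p).
have f_inj : injective f by move=> p q /(congr1 val)/pos_inj.
have f_bij : bijective f by apply: inj_card_bij; rewrite // card_ord.
have -> : prefix t k = f @^-1: [set i : 'I_#|V| | i < k] by apply/setP => p; rewrite !inE.
rewrite on_card_preimset; last by case: f_bij => g fK gK; exists g => x _;
  [apply: fK | apply: gK].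
by rewrite -sum1dep_card (big_ord_narrow kV) sum1_card card_ord.
Qed.

Lemma prefix_mono t k l : k <= l -> prefix t k \subset prefix t l.
Proof. by move=> kl; apply/fintype.subsetP => p; rewrite !inE => /leq_trans; apply. Qed.

Lemma reds_mono t k l : k <= l -> reds t k <= reds t l.
Proof. by move=> kl; apply: subset_leq_card; apply: finset.setIS; apply: prefix_mono. Qed.

Lemma prefixS t p : prefix t (pos t p).+1 = p |: prefix t (pos t p).
Proof.
apply/setP => q; rewrite !inE ltnS leq_eqVlt; congr orb.
exact: inj_eq (@pos_inj t) q p.
Qed.

Lemma redsS t p : reds t (pos t p).+1 = reds t (pos t p) + (p \in R).
Proof.
rewrite /reds prefixS; have [pR|pR] := boolP (p \in R).
  have -> : R :&: (p |: prefix t (pos t p)) = p |: (R :&: prefix t (pos t p)).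
    by apply/setP=> q; rewrite !inE; case: eqVneq => // ->; rewrite pR.
  by rewrite cardsU1 !inE ltnn andbF addnC.
rewrite addn0; congr #|pred_of_set _|; apply/setP => q; rewrite !inE.
by case: eqVneq => // ->; rewrite (negbTE pR).
Qed.

Lemma lt_same t p q : (p, q) != (a t, b t) -> (p, q) != (b t, a t) -> lt (t + u)%R p q = lt t p q.
Proof. by move=> n1 n2; apply: contraNeq n1 => /lt_swap [->|E] //; rewrite E eqxx in n2. Qed.

Lemma a_neq_b t : a t != b t.
Proof. by apply: contraTneq (lt_ab t) => ->; rewrite lt_irr. Qed.

Lemma pos_step t p : p != a t -> p != b t -> pos (t + u)%R p = pos t p.
Proof.
move=> pa pb; apply: eq_card => q; rewrite !inE; apply: lt_same.
  by rewrite xpair_eqE (negbTE pb) andbF.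
by rewrite xpair_eqE (negbTE pa) andbF.
Qed.

(** Only the two exchanged points change position, each by one; as they also change
    their relative order, they are neighbours. *)
Lemma pos_ab t : [/\ pos t (b t) = cut t, pos (t + u)%R (a t) = cut t &
  pos (t + u)%R (b t) = pos t (a t)].
Proof.
have posa : pos (t + u)%R (a t) = (pos t (a t)).+1.
  rewrite /pos (cardD1 (b t)) !inE lt_ba add1n; congr _.+1; apply: eq_card => q.
  rewrite !inE; have [->|qb] /= := eqVneq; first by rewrite lt_asym ?lt_ab.
  by apply: lt_same; rewrite xpair_eqE ?(negbTE qb) // (negbTE (a_neq_b t)) andbF.
have posb : (pos (t + u)%R (b t)).+1 = pos t (b t).
  rewrite {2}/pos (cardD1 (a t)) !inE lt_ab add1n; congr _.+1; apply: eq_card => q.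
  rewrite !inE; have [->|qa] /= := eqVneq; first by rewrite lt_asym ?lt_ba.
  by apply: lt_same;
    rewrite xpair_eqE ?(negbTE qa) // [b t == _]eq_sym (negbTE (a_neq_b t)) andbF.
have := lt_ba t; have := lt_ab t; rewrite -!ltn_pos posa -posb /cut.
by split=> //; lia.
Qed.

Lemma prefix_step t k : k != cut t -> prefix (t + u)%R k = prefix t k.
Proof.
move=> kc; have [pb pa' pb'] := pos_ab t; apply/setP => p; rewrite !inE.
have [->|pa] := eqVneq p (a t); first by rewrite pa'; move: kc; rewrite /cut; lia.
have [->|pNb] := eqVneq p (b t); first by rewrite pb' pb; move: kc; rewrite /cut; lia.
by rewrite pos_step.
Qed.

Lemma reds_step t k : k != cut t -> reds (t + u)%R k = reds t k.
Proof. by move=> kc; rewrite /reds prefix_step. Qed.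

Lemma sign_step t q : sign t q != sign (t + u)%R q -> 0 < q /\ (d + q.*2).-1 = cut t.
Proof.
case: q => [|q] sq; first by rewrite /sign !ltn0 in sq.
split=> //; apply/eqP; apply: contraNT sq => /reds_step E.
by rewrite /sign E.
Qed.

Lemma pos_opp t p : pos (t + h)%R p = #|V| - (pos t p).+1.
Proof.
have -> : pos (t + h)%R p = #|~: (p |: [set q | lt t q p])|.
  apply: eq_card => q; rewrite !inE lt_opp.
  have [->|qp] /= := eqVneq; first by rewrite lt_irr.
  have := lt_total t qp; have [qp'|] := boolP (lt t q p); first by rewrite lt_asym.
  by [].
by rewrite cardsCs finset.setCK cardsU1 inE lt_irr.
Qed.

Lemma prefix_opp t k : k <= #|V| -> prefix (t + h)%R k = ~: prefix t (#|V| - k).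
Proof.
by move=> kV; apply/setP => p; rewrite !inE pos_opp; have := ltn_pos_card t p; lia.
Qed.

Lemma reds_opp t k : k <= #|V| -> reds (t + h)%R k + reds t (#|V| - k) = r.
Proof.
by move=> kV; rewrite /reds prefix_opp // -(cardsID (prefix t (#|V| - k)) R) finset.setDE addnC.
Qed.

Lemma leq_reds t k : reds t k <= r.
Proof. by apply: subset_leq_card; apply: finset.subsetIl. Qed.

Lemma sign_first t : sign t 0 = false.
Proof. by rewrite /sign ltn0. Qed.

Lemma sign_last t : sign t r.+1 = true.
Proof. by rewrite /sign ltnS leq_reds. Qed.

Lemma sign_opp t q : q <= r.+1 -> sign (t + h)%R q = ~~ sign t (r.+1 - q).
Proof.
case: q => [_|q]; first by rewrite sign_first subn0 sign_last.
rewrite subSS; rewrite leq_eqVlt => /predU1P[[->]|qr]; first by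
  rewrite subnn sign_first sign_last.
have := @reds_opp t (d + q.+1.*2).-1; rewrite card_V /sign => E.
have -> : (d + (r - q).*2).-1 = (d + r).*2 - (d + q.+1.*2).-1 by lia.
have {}E : (d + q.+1.*2).-1 <= (d + r).*2 -> _ := E.
have := E _; lia.
Qed.

Definition colour c : {set V} := if c then ~: R else R.
Definition side c (x : Z * nat) : {set V} := colour c :&: prefix x.1 (d + x.2.*2).
Definition diff c x y : nat := #|side c x :\: side c y| + #|side c y :\: side c x|.

Lemma diffC c x y : diff c x y = diff c y x.
Proof. exact: addnC. Qed.

Lemma diff_triangle c x y z : diff c x z <= diff c x y + diff c y z.
Proof.
have le (A B C : {set V}) : #|A :\: C| <= #|A :\: B| + #|B :\: C|.
  apply: leq_trans (leq_card_setU _ _); apply: subset_leq_card.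
  by apply/fintype.subsetP => v; rewrite !inE => /andP[-> ->]; case: (v \in B).
by have := le (side c x) (side c y) (side c z); have := le (side c z) (side c y) (side c x);
  rewrite /diff; lia.
Qed.

Local Notation wall := (wall #|R| sign).

Lemma leq_redsS t k : reds t k.+1 <= (reds t k).+1.
Proof.
have [p /eqP <-|nk] := pickP (fun p => pos t p == k); first by rewrite redsS; case: (_ \in R);
  lia.
suff -> : reds t k.+1 = reds t k by [].
by congr #|pred_of_set (R :&: _)|; apply/setP => p; rewrite !inE ltnS leq_eqVlt nk.
Qed.

(** The signs bound the number of red points one position before the wall and one
    position after; it is monotone and grows by at most one per position. *)
Lemma wall_reds t q : wall (t, q) -> reds t (d + q.*2) = q.
Proof.
case/andP => /= _; rewrite /sign doubleS !addnS /=.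
have := leq_redsS t (d + q.*2); have := leq_redsS t (d + q.*2).-1.
have := @reds_mono t _ _ (leq_pred (d + q.*2)).
have := @reds_mono t _ _ (leqnSn (d + q.*2)).
by case: (d + q.*2) => [|k] /=; lia.
Qed.

(** The same bounds show that both points next to a falling wall are red and both
    points next to a rising wall are blue. *)
Lemma wall_swap t q : wall (t, q) -> cut t = d + q.*2 ->
  (a t \in R) = sign t q /\ (b t \in R) = sign t q.
Proof.
move=> wq ct; have rq := wall_reds wq; have [pb _ _] := pos_ab t.
have := redsS t (a t); have := redsS t (b t); rewrite pb -/(cut t) ct rq.
have -> : pos t (a t) = (d + q.*2).-1 by rewrite -ct.
case/andP: wq => /= _; rewrite /sign doubleS !addnS /=.
by case: (a t \in R) (b t \in R) => [] []; lia.
Qed.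

Lemma card_side c t q : wall (t, q) -> #|side c (t, q)| = if c then d + q else q.
Proof.
move=> wq; have rq := wall_reds wq; rewrite /side /colour /=; case: c => //.
rewrite finset.setIC -finset.setDE; have := cardsID R (prefix t (d + q.*2)).
rewrite finset.setIC -/(reds _ _) rq card_prefix /=; first by move=> E; apply: (@addnI q);
  rewrite E; lia.
by case/andP: wq => /= qr _; rewrite card_V; lia.
Qed.

Lemma diff_subset (A B : {set V}) : A \subset B -> #|A :\: B| + #|B :\: A| = #|B| - #|A|.
Proof.
by move=> AB;
  rewrite (eqP (_ : A :\: B == finset.set0)) ?finset.setD_eq0 // cards0 cardsD
  (finset.setIidPr AB).
Qed.

Lemma side_mono c t k l : k <= l -> side c (t, k) \subset side c (t, l).
Proof. by move=> kl; apply/finset.setIS/prefix_mono => /=; lia. Qed.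

Lemma diff_level c t p q : wall (t, p) -> wall (t, q) -> diff c (t, p) (t, q) <= dist p q.
Proof.
move=> wp wq; have [pq|/ltnW qp] := leqP p q; last rewrite diffC.
  by rewrite /diff diff_subset ?side_mono // !card_side // /dist; case: c; lia.
by rewrite /diff diff_subset ?side_mono // !card_side // /dist; case: c; lia.
Qed.

Lemma side_step c t q : cut t != d + q.*2 -> side c ((t + u)%R, q) = side c (t, q).
Proof. by move=> ct; rewrite /side prefix_step // eq_sym. Qed.

(** When the exchange takes place at the wall itself, the exchanged points have the
    colour that [side] ignores for a wall of this direction. *)
Lemma diff_stay t q : wall (t, q) -> wall ((t + u)%R, q) -> sign (t + u)%R q = sign t q ->
  diff (sign t q) (t, q) ((t + u)%R, q) = 0.
Proof.
move=> wq _ _; suff E : side (sign t q) ((t + u)%R, q) = side (sign t q) (t, q).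
  by rewrite /diff E finset.setDv cards0.
have [ct|] := eqVneq (cut t) (d + q.*2); last exact: side_step.
have [aR bR] := wall_swap wq ct; have [_ _ pb] := pos_ab t.
rewrite /side /= -ct /cut -{1}pb !prefixS pb prefix_step; last by rewrite /cut; lia.
apply/setP => v; rewrite !inE; have [->|_] := eqVneq v (b t).
  rewrite /colour; case: (sign t q) bR => bR; rewrite ?inE bR //.
have [->|_] := eqVneq v (a t).
  rewrite /colour; case: (sign t q) aR => aR; rewrite ?inE aR //.
by [].
Qed.

Lemma diff_up c t q : wall (t, q) -> wall ((t + u)%R, q.+1) ->
  sign t q.+1 != sign (t + u)%R q.+1 ->
  diff c (t, q) ((t + u)%R, q.+1) <= 1.
Proof.
move=> wt wu /sign_step[_ ct]; have ctq : cut t != d + q.*2 by lia.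
rewrite /diff -side_step // diff_subset ?side_mono // card_side // side_step // card_side //.
by case: c; lia.
Qed.

Lemma diff_down c t q : wall (t, q.+1) -> wall ((t + u)%R, q) ->
  sign t q.+1 != sign (t + u)%R q.+1 ->
  diff c (t, q.+1) ((t + u)%R, q) <= 1.
Proof.
move=> wt wu /sign_step[_ ct]; have ctq : cut t != d + q.*2 by lia.
have E := side_step c ctq.
rewrite diffC /diff E diff_subset ?side_mono // -E !card_side //.
by case: c {E}; lia.
Qed.

Lemma diff_antipode c x : wall x -> r <= diff c x (antipode h r x).
Proof.
case: x => t q /andP[/= qr _]; have kV : d + (r - q).*2 <= #|V| by rewrite card_V; lia.
have -> : diff c (t, q) (antipode h r (t, q)) = #|colour c|.
  rewrite /diff /side /antipode /= prefix_opp //.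
  have -> : #|V| - (d + (r - q).*2) = d + q.*2 by rewrite card_V; lia.
  rewrite -[RHS](cardsID (prefix t (d + q.*2))); congr (_ + _);
  by apply: eq_card => v; rewrite !inE; case: (v \in colour c) (_ < _) => [] [].
rewrite /colour; case: c => //.
by have := cardsC R; rewrite card_V; lia.
Qed.

Hypothesis u_neq0 : u != 0%R.
Hypothesis hh : (h + h = 0)%R.

(** A sign changes only when the exchanged points have different colours and the
    points before them have q - 1 red points among d + 2 (q - 1). *)
Theorem twice_le_balanced_swaps N : h = (u *+ N)%R ->
  r.*2 <= #|[set t | ((a t \in R) != (b t \in R)) &&
     (#|[set p | lt t p (a t)] :\: R| == d + #|[set p | lt t p (a t)] :&: R|)]|.
Proof.
move=> hN.
have sparse_sign : sparse sign u.
  by move=> t p q /sign_step[p0 pc] /sign_step[q0 qc]; lia.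
have := twice_le_flips sign_first sign_last sign_opp hh sparse_sign u_neq0
  diffC diff_triangle diff_level diff_stay diff_up diff_down diff_antipode hN.
rewrite mul2n => /leq_trans; apply; apply: subset_leq_card.
apply/fintype.subsetP => t; rewrite !inE => /existsP[q fq].
have [q0 ct] := sign_step fq; have [_ _ pb] := pos_ab t.
have below : [set p | lt t p (a t)] = prefix t (pos t (a t)).
  by apply/setP => p; rewrite !inE ltn_pos.
have ra := redsS t (a t); have rb := redsS (t + u)%R (b t).
move: ra rb; rewrite pb (@reds_step t (pos t (a t))) -/(cut t) => [ra rb|]; last by
  rewrite /cut; lia.
have card_below : #|prefix t (pos t (a t))| = d + q.-1.*2.
  have kV : pos t (a t) <= #|V| by apply/ltnW/ltn_pos_card.
  by rewrite card_prefix //; move: ct; rewrite /cut; lia.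
have := cardsID R (prefix t (pos t (a t))); rewrite card_below below.
rewrite finset.setIC -/(reds _ _).
move: fq; rewrite /sign ct ra rb.
move: (#|_ :\: R|) => B; case: (a t \in R) (b t \in R) => [] []; lia.
Qed.

End Sweep.

(** * Orders generated by a ranking of the pairs *)

Section Sorting.

Variables (V : finType) (lo : rel V) (L : seq (V * V)) (e0 : V * V) (N' : nat).

Local Notation N := N'.+1.
Local Notation time := 'I_N'.*2.+2.
Local Notation u := (inZp 1 : time).
Local Notation h := (inZp N : time).

Hypothesis lo_irr : irreflexive lo.
Hypothesis lo_trans : transitive lo.
Hypothesis lo_total : forall p q, p != q -> lo p q || lo q p.
Hypothesis L_uniq : uniq L.
Hypothesis mem_L : forall p q, ((p, q) \in L) = lo p q.
Hypothesis size_L : size L = N.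
Hypothesis L_between : forall x y z, lo x y -> lo y z ->
  (index (x, y) L < index (x, z) L < index (y, z) L) ||
  (index (y, z) L < index (x, z) L < index (x, y) L).

(** The order reached from [lo] once the pairs of rank less than k in L have been
    exchanged. *)
Definition sorted_upto k p q : bool :=
  if lo p q then k <= index (p, q) L else lo q p && (index (q, p) L < k).

(** During the second half turn the same exchanges are undone, which is read as the
    first half turn for the reversed orders. *)
Definition half_turn (t : time) : nat := if t < N then t : nat else t - N.

Definition order_at (t : time) p q : bool :=
  if t < N then sorted_upto t p q else sorted_upto (t - N) q p.

Definition edge k : V * V := nth e0 L k.
Definition lower (t : time) : V := if t < N then (edge t).1 else (edge (t - N)).2.
Definition upper (t : time) : V := if t < N then (edge t).2 else (edge (t - N)).1.

Lemma lo_asym p q : lo p q -> lo q p = false.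
Proof. by move=> pq; apply/negP => /(lo_trans pq); rewrite lo_irr. Qed.

Lemma sorted_upto_irr k : irreflexive (sorted_upto k).
Proof. by move=> p; rewrite /sorted_upto lo_irr. Qed.

Lemma sorted_upto_total k p q : p != q -> sorted_upto k p q || sorted_upto k q p.
Proof.
move=> /lo_total/orP[] pq; rewrite /sorted_upto pq (lo_asym pq) /=.
  by rewrite ltnNge orbN.
by rewrite orbC ltnNge orbN.
Qed.

(** In a triple the outer pair is exchanged between the two inner ones, so that the
    exchanged pairs never create a cycle. *)
Lemma sorted_upto_trans k : transitive (sorted_upto k).
Proof.
move=> q p s; rewrite /sorted_upto.
have [pq kpq|_ /andP[qp kqp]] := ifPn (lo p q).
  have [qs kqs|_ /andP[sq ksq]] := ifPn (lo q s).
    rewrite (lo_trans pq qs); have := L_between pq qs; lia.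
  have [E|/lo_total/orP[ps|sp]] := eqVneq p s; first by subst; lia.
    by rewrite ps; have := L_between ps sq; lia.
  by rewrite (lo_asym sp) sp /=; have := L_between sp pq; lia.
have [qs kqs|_ /andP[sq ksq]] := ifPn (lo q s).
  have [E|/lo_total/orP[ps|sp]] := eqVneq p s; first by subst; lia.
    by rewrite ps; have := L_between qp ps; lia.
  by rewrite (lo_asym sp) sp /=; have := L_between qs sp; lia.
have sp := lo_trans sq qp; rewrite (lo_asym sp) sp /=.
have := L_between sq qp; lia.
Qed.

Lemma sorted_upto0 p q : sorted_upto 0 p q = lo p q.
Proof. by rewrite /sorted_upto leq0n ltn0 andbF; case: (lo p q). Qed.

Lemma sorted_uptoN p q : sorted_upto N p q = lo q p.
Proof.
rewrite /sorted_upto -size_L; case: ifPn => [pq|npq].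
  by rewrite leqNgt index_mem mem_L pq lo_asym.
by case qp: (lo q p) => //=; rewrite index_mem mem_L qp.
Qed.

Lemma edge_index k : k < N -> lo (edge k).1 (edge k).2 /\ index (edge k) L = k.
Proof.
move=> kN; rewrite -mem_L -surjective_pairing mem_nth ?size_L //.
by rewrite index_uniq ?size_L.
Qed.

Lemma sorted_upto_edge k : k < N ->
  sorted_upto k (edge k).1 (edge k).2 /\ sorted_upto k.+1 (edge k).2 (edge k).1.
Proof.
move=> /edge_index; case: (edge k) => p q /= [pq ik].
by rewrite /sorted_upto pq (lo_asym pq) /= ik ltnSn leqnn.
Qed.

Lemma sorted_uptoS k p q : sorted_upto k.+1 p q != sorted_upto k p q ->
  edge k = (p, q) \/ edge k = (q, p).
Proof.
rewrite /sorted_upto; case: ifPn => [pq|_].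
  have [<- _|ne] := eqVneq (index (p, q) L) k; first by left; rewrite /edge nth_index ?mem_L.
  by move=> H; exfalso; lia.
have [qp|//] := boolP (lo q p).
have [<- _|ne] := eqVneq (index (q, p) L) k; first by right; rewrite /edge nth_index ?mem_L.
by move=> H; exfalso; lia.
Qed.

Lemma order_at_succ (t : time) p q : order_at (t + u)%R p q =
  if t < N then sorted_upto t.+1 p q else sorted_upto (t - N).+1 q p.
Proof.
have vu : nat_of_ord (t + u)%R = if t.+1 == N'.*2.+2 then 0 else t.+1.
  rewrite /= modnDmr addn1; case: eqP => [->|]; first by rewrite modnn.
  by move=> ne; rewrite modn_small //; have := ltn_ord t; lia.
have tm := ltn_ord t; rewrite /order_at vu.
have [tN|Nt] := ltnP t N; last first.
  have [te|tne] /= := eqVneq t.+1 N'.*2.+2.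
    by rewrite sorted_upto0 (_ : (t - N).+1 = N) ?sorted_uptoN //; lia.
  have -> : (t.+1 < N) = false by lia.
  by congr sorted_upto; lia.
have -> : (t.+1 == N'.*2.+2) = false by lia.
have [->|ne] := eqVneq (nat_of_ord t) N'; last by rewrite ifT //; lia.
by rewrite ltnn subnn sorted_upto0 sorted_uptoN.
Qed.

Lemma order_at_opp (t : time) p q : order_at (t + h)%R p q = order_at t q p.
Proof.
have vh : nat_of_ord (t + h)%R = if t < N then t + N else t - N.
  have tm := ltn_ord t; rewrite /= modnDmr; case: ltnP => tN.
    by rewrite modn_small //; lia.
  have -> : t + N = (t - N) + N'.*2.+2 by lia.
  by rewrite modnDr modn_small //; lia.
have tm := ltn_ord t; rewrite /order_at vh.
have [tN|Nt] := ltnP t N; first by rewrite ifF ?addnK //; lia.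
by rewrite ifT //; lia.
Qed.

Variables (R : {set V}) (d : nat).
Hypothesis card_V : #|V| = (d + #|R|).*2.

(** The points before the exchanged pair, at the k-th step of either half turn; in
    the second half turn these are the points after the pair in the first one. *)
Definition beside (x : bool * 'I_N) : {set V} :=
  if x.1 then [set v | sorted_upto x.2 (edge x.2).2 v] else [set v | sorted_upto x.2 v (edge
    x.2).1].

Theorem twice_le_balanced_edges :
  #|R|.*2 <= #|[set x : bool * 'I_N | (((edge x.2).1 \in R) != ((edge x.2).2 \in R)) &&
     (#|beside x :\: R| == d + #|beside x :&: R|)]|.
Proof.
have u_neq0 : u != 0%R by [].
have hh : (h + h = 0)%R by apply: val_inj; rewrite /= modnDm addnn modnn.
have hN : h = (u *+ N)%R by rewrite Zp_mulrn; apply: val_inj; rewrite /= modnMml mul1n.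
have irr t : irreflexive (order_at t).
  by move=> p; rewrite /order_at !sorted_upto_irr if_same.
have trans t : transitive (order_at t).
  move=> q p s; rewrite /order_at; case: (t < N); first exact: sorted_upto_trans.
  by move=> qp sq; apply: sorted_upto_trans sq qp.
have total t p q : p != q -> order_at t p q || order_at t q p.
  by move=> pq; rewrite /order_at; case: (t < N); rewrite sorted_upto_total // eq_sym.
have ltm (t : time) : (t < N)%N = false -> t - N < N by have := ltn_ord t; lia.
have lt_ab t : order_at t (lower t) (upper t).
  rewrite /order_at /lower /upper; case tN: (t < N); last move/ltm: tN => tN.
    by have [] := sorted_upto_edge tN.
  by have [] := sorted_upto_edge tN.
have lt_ba t : order_at (t + u)%R (upper t) (lower t).
  rewrite order_at_succ /lower /upper; case tN: (t < N); last move/ltm: tN => tN.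
    by have [] := sorted_upto_edge tN.
  by have [] := sorted_upto_edge tN.
have swap t p q : order_at (t + u)%R p q != order_at t p q ->
    (p, q) = (lower t, upper t) \/ (p, q) = (upper t, lower t).
  rewrite order_at_succ /order_at /lower /upper.
  by case: (t < N) => /sorted_uptoS[] -> /=; auto.
have := twice_le_balanced_swaps card_V irr trans total order_at_opp lt_ab lt_ba swap u_neq0 hh hN.
move=> /leq_trans; apply.
have half t : half_turn t < N by rewrite /half_turn; case: ifP => // /ltm.
pose f (t : time) : bool * 'I_N := (N <= t, Ordinal (half t)).
rewrite -(card_imset _ (_ : injective f)); last first.
  move=> s t [E]; rewrite /half_turn => E'; apply: val_inj; move: E E' => /=.
  by case: (ltnP s N) => sN; case: (ltnP t N) => tN; lia.
apply/subset_leq_card/fintype.subsetP => x /imsetP[t + ->]; rewrite !finset.in_set => good.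
have E : [set p | order_at t p (lower t)] = beside (f t).
  rewrite /beside /=; apply/setP => v; rewrite /order_at /lower /half_turn (leqNgt N t).
  by case: (t < N); rewrite /= !finset.in_set.
move: good; rewrite E => /andP[ab ->]; rewrite andbT.
rewrite -[nat_of_ord (f t).2]/(half_turn t).
move: ab; rewrite /lower /upper /half_turn; case: (t < N) => //.
by rewrite eq_sym.
Qed.

End Sorting.

(** * Sorting the pairs of points by slope *)

Section Plane.

Local Open Scope ring_scope.

Variable K : realType.
Implicit Types p q x y z : plane K.

Definition lex p q : bool := (p.1 < q.1) || (p.1 == q.1) && (p.2 < q.2).

Definition cross p q x y : K := (q.1 - p.1) * (y.2 - x.2) - (q.2 - p.2) * (y.1 - x.1).

Definition orient p q x : K := cross p q p x.

Lemma lex_irr : irreflexive lex.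
Proof. by move=> p; rewrite /lex !ltxx andbF. Qed.

Lemma lex_trans : transitive lex.
Proof.
move=> q p x /orP[pq|/andP[/eqP pq pq']] /orP[qx|/andP[/eqP qx qx']].
- by rewrite /lex (lt_trans pq qx).
- by rewrite /lex -qx pq.
- by rewrite /lex pq qx.
- by rewrite /lex pq qx eqxx (lt_trans pq' qx') orbT.
Qed.

Lemma lex_total p q : p != q -> lex p q || lex q p.
Proof.
case: p q => [a b] [c d]; rewrite xpair_eqE /lex /=.
by case: (ltgtP a c) => //= _; case: (ltgtP b d).
Qed.

Lemma lexP p q : lex p q -> 0 <= q.1 - p.1 /\ (q.1 = p.1 -> 0 < q.2 - p.2).
Proof.
move=> /orP[pq|/andP[/eqP pq pq']]; rewrite !subr_ge0 ?subr_gt0; split=> //.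
- exact: ltW.
- by move=> E; rewrite E ltxx in pq.
- by rewrite pq.
Qed.

Lemma crossC p q x y : cross x y p q = - cross p q x y.
Proof. by rewrite /cross; ring. Qed.

(** Lexicographically positive vectors have angles in a half-open interval of length
    pi, on which the sign of the cross product compares the angles. *)
Lemma cross_trans p q x y z w : lex p q -> lex x y -> lex z w ->
  0 <= cross p q x y -> 0 <= cross x y z w -> 0 <= cross p q z w.
Proof.
move=> /lexP[]; rewrite /cross; set a := q.1 - p.1; set a' := q.2 - p.2 => a0 aE.
move=> /lexP[]; set b := y.1 - x.1; set b' := y.2 - x.2 => b0 bE.
move=> /lexP[]; set c := w.1 - z.1; set c' := w.2 - z.2 => c0 cE ab bc.
have [b_eq0|b_neq0] := eqVneq b 0; last first.
  have b_gt0 : 0 < b by rewrite lt_neqAle eq_sym b_neq0.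
  rewrite -(pmulr_rge0 _ b_gt0).
  have -> : b * (a * c' - a' * c) = (a * b' - a' * b) * c + (b * c' - b' * c) * a by ring.
  by rewrite addr_ge0 // mulr_ge0.
have b'_gt0 : 0 < b' by apply: bE; apply/eqP; rewrite -subr_eq0 -/b b_eq0.
have c_eq0 : c = 0.
  apply/eqP; rewrite eq_le c0 andbT -(pmulr_rle0 _ b'_gt0).
  by move: bc; rewrite b_eq0 mul0r sub0r oppr_ge0.
have c'_gt0 : 0 < c' by apply: cE; apply/eqP; rewrite -subr_eq0 -/c c_eq0.
by rewrite c_eq0 mulr0 subr0 mulr_ge0 // ltW.
Qed.

Definition line_through p q : set (plane K) :=
  line_of (p.2 - q.2) (q.1 - p.1) ((p.2 - q.2) * p.1 + (q.1 - p.1) * p.2).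

Lemma line_throughE p q x : line_through p q x <-> orient p q x = 0.
Proof.
rewrite /line_through /line_of /orient /cross /=; split=> E.
  by move/eqP: E; rewrite -subr_eq0 => /eqP <-; ring.
by apply/eqP; rewrite -subr_eq0 -E; apply/eqP; ring.
Qed.

Lemma is_line_through p q : p != q -> is_line (line_through p q).
Proof.
move=> pq; do 3!eexists; split; last by [].
apply: contraNneq pq => -[/eqP E2 /eqP E1]; apply/eqP.
move: E1 E2; rewrite !subr_eq0 => /eqP E1 /eqP E2.
by case: (p) (q) E1 E2 => [? ?] [? ?] /= -> ->.
Qed.

Lemma orient_l p q : orient p q p = 0.
Proof. by rewrite /orient /cross; ring. Qed.

Lemma orient_r p q : orient p q q = 0.
Proof. by rewrite /orient /cross; ring. Qed.

Lemma orient_collinear p q x : p != q -> orient p q x = 0 -> collinear p q x.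
Proof.
move=> pq pqx; exists (line_through p q); split; first exact: is_line_through.
- exact/line_throughE/orient_l.
- exact/line_throughE/orient_r.
- exact/line_throughE.
Qed.

(** Two equations of the line are proportional, and so are the linear forms that cut
    out its sides. *)
Lemma halfplane_orient p q (h : set (plane K)) : p != q ->
  open_halfplane_of (line_through p q) h ->
  (forall x, (x \in h) = (orient p q x < 0)) \/ (forall x, (x \in h) = (0 < orient p q x)).
Proof.
move=> pq [a [b [c [ab lE ->]]]].
have [lp lq] : line_of a b c p /\ line_of a b c q.
  by rewrite -lE; split; apply/line_throughE; rewrite ?orient_l ?orient_r.
have [l l0 lE'] : exists2 l, l != 0 & forall x, a * x.1 + b * x.2 - c = l * orient p q x.
  move: lp lq; rewrite /line_of /orient /cross /= => lp lq.
  have ortho : a * (q.1 - p.1) + b * (q.2 - p.2) = 0 by rewrite -(subrr c) -{1}lq -lp; ring.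
  have rel x : a * x.1 + b * x.2 - c = a * (x.1 - p.1) + b * (x.2 - p.2) by rewrite -lp; ring.
  have [d1|d1] := eqVneq (q.1 - p.1) 0.
    have d2 : q.2 - p.2 != 0.
      apply: contra pq; rewrite subr_eq0 => /eqP E2; apply/eqP.
      move/eqP: d1; rewrite subr_eq0 => /eqP E1.
      by case: (p) (q) E1 E2 => [? ?] [? ?] /= -> ->.
    have b0 : b = 0.
      by apply: (mulIf d2); rewrite mul0r; move: ortho; rewrite d1 mulr0 add0r.
    exists (- a / (q.2 - p.2)); last by move=> x; rewrite rel b0 d1; field.
    rewrite mulf_neq0 ?invr_eq0 // oppr_eq0; apply: contra ab => /eqP ->.
    by rewrite b0.
  have aE : a = - b * (q.2 - p.2) / (q.1 - p.1).
    by apply: (mulIf d1); rewrite mulfVK // mulNr; apply/eqP; rewrite -addr_eq0 ortho.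
  exists (b / (q.1 - p.1)); last by move=> x; rewrite rel aE; field.
  rewrite mulf_neq0 ?invr_eq0 //; apply: contra ab => /eqP b0.
  by rewrite aE b0 oppr0 !mul0r.
have memE x : (x \in [set y : plane K | a * y.1 + b * y.2 < c]%classic) = (a * x.1 + b * x.2 -
  c < 0).
  by rewrite subr_lt0; apply/idP/idP; rewrite inE.
have [l_lt0|l_gt0|l_eq0] := ltgtP l 0; last by rewrite l_eq0 eqxx in l0.
  by right=> x; rewrite memE lE' nmulr_rlt0.
by left=> x; rewrite memE lE' pmulr_rlt0.
Qed.

Variables B R : {fset plane K}.
Hypothesis disjBR : (B `&` R = fset0)%fset.
Hypothesis genpos : general_position (B `|` R)%fset.
Hypothesis leRB : (#|` R| <= #|` B|)%N.
Hypothesis evenBR : ~~ odd (#|` B| + #|` R|).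

Local Notation P := (B `|` R)%fset.
Local Notation d := (delta B R).

Definition red : {set P} := fsub P R.

Lemma in_red (x : P) : (x \in red) = (val x \in R).
Proof. by rewrite in_fsub. Qed.

Lemma card_red : #|red| = #|` R|.
Proof. by rewrite card_fsub // fsubsetUr. Qed.

Lemma in_blue (x : P) : (val x \in B) = (x \notin red).
Proof.
rewrite in_red; have := valP x; rewrite inE => /orP[] xB; rewrite xB ?orbT.
  apply/esym/negP => xR; have : val x \in (B `&` R)%fset by rewrite inE xB.
  by rewrite disjBR inE.
apply/negP => xB'; have : val x \in (B `&` R)%fset by rewrite inE xB'.
by rewrite disjBR inE.
Qed.

Lemma card_points : #|{: P}| = (d + #|red|).*2.
Proof.
rewrite -cardfE; have := cardfsUI B R; rewrite disjBR cardfs0 addn0 card_red /delta.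
move: leRB evenBR; lia.
Qed.

Lemma count_in_blue (S : {set P}) h : (forall x : P, (val x \in h) = (x \in S)) ->
  count_in B h = #|S :\: red|.
Proof.
move=> hS; rewrite /count_in -(@card_fsub _ P); last first.
  by apply/fsubsetP => x; rewrite !inE => /andP[-> _].
by apply: eq_card => x; rewrite in_fsub !inE hS -in_red -in_blue andbC.
Qed.

Lemma count_in_red (S : {set P}) h : (forall x : P, (val x \in h) = (x \in S)) ->
  count_in R h = #|S :&: red|.
Proof.
move=> hS; rewrite /count_in -(@card_fsub _ P); last first.
  by apply/fsubsetP => x; rewrite !inE => /andP[-> _]; rewrite orbT.
by apply: eq_card => x; rewrite in_fsub !inE hS -in_red andbC in_red.
Qed.

Definition lo (x y : P) : bool := lex (val x) (val y).

(** Parallel pairs are tied and sorted arbitrarily; they have no point in common. *)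
Definition slope_le (e f : P * P) : bool := 0 <= cross (val e.1) (val e.2) (val f.1) (val f.2).

Definition edges : seq (P * P) := sort slope_le [seq e <- enum {: P * P} | lo e.1 e.2].

Lemma edges_uniq : uniq edges.
Proof. by rewrite sort_uniq filter_uniq // enum_uniq. Qed.

Lemma mem_edges (x y : P) : ((x, y) \in edges) = lo x y.
Proof. by rewrite mem_sort mem_filter mem_enum andbT. Qed.

Lemma lo_total (x y : P) : x != y -> lo x y || lo y x.
Proof. by move=> xy; apply: lex_total; rewrite (inj_eq val_inj). Qed.

Lemma index_edges (x y z w : P) : lo x y -> lo z w -> 0 < cross (val x) (val y) (val z) (val w) ->
  (index (x, y) edges < index (z, w) edges)%N.
Proof.
move=> xy zw c_gt0; rewrite ltnNge leq_eqVlt negb_or; apply/andP; split.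
  apply/eqP => E; have := nth_index (x, y) (_ : (x, y) \in edges).
  rewrite mem_edges -E nth_index ?mem_edges // => /(_ xy) [zx wy].
  by move: c_gt0; rewrite zx wy /cross mulrC subrr ltxx.
apply/negP => zw_xy.
have sub : {subset edges <= [pred e | lo e.1 e.2]} by case=> ? ?; rewrite mem_edges.
have tr : {in edges & &, transitive slope_le}.
  move=> [q1 q2] [p1 p2] [s1 s2] /sub /= qL /sub /= pL /sub /= sL; exact: cross_trans.
have so : sorted slope_le edges.
  apply: (@sort_sorted_in _ [pred e : P * P | true]).
    by move=> e f _ _; rewrite /slope_le crossC oppr_ge0; apply: ge_total.
  exact/allP.
have := sorted_ltn_index_in tr so; move=> /(_ (z, w) (x, y));
  rewrite !mem_edges => /(_ zw xy zw_xy).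
by rewrite /slope_le crossC oppr_ge0 leNgt c_gt0.
Qed.

Lemma orient_neq0 (x y z : P) : x != y -> x != z -> y != z -> orient (val x) (val y) (val z) != 0.
Proof.
move=> xy xz yz; apply/eqP => E; apply: (genpos (valP x) (valP y) (valP z)).
1-3: by rewrite (inj_eq val_inj).
by apply: orient_collinear => //; rewrite (inj_eq val_inj).
Qed.

Lemma lo_neq (x y : P) : lo x y -> x != y.
Proof. by apply: contraTneq => ->; rewrite /lo lex_irr. Qed.

(** The three cross products of the sides of a triangle are all equal to its
    orientation. *)
Lemma edges_between (x y z : P) : lo x y -> lo y z ->
  (index (x, y) edges < index (x, z) edges < index (y, z) edges)%N ||
  (index (y, z) edges < index (x, z) edges < index (x, y) edges)%N.
Proof.
move=> xy yz; have xz : lo x z := lex_trans xy yz.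
have := orient_neq0 (lo_neq xy) (lo_neq xz) (lo_neq yz); rewrite neq_lt => /orP[] c.
  apply/orP; right; apply/andP; split; apply: index_edges => //;
    by rewrite -oppr_lt0; apply: le_lt_trans c; rewrite /orient /cross le_eqVlt; apply/orP;
      left; apply/eqP; ring.
apply/orP; left; apply/andP; split; apply: index_edges => //;
  by apply: lt_le_trans c _; rewrite /orient /cross le_eqVlt; apply/orP; left; apply/eqP; ring.
Qed.

Lemma index_edges_lt (x y z w : P) : lo x y -> lo z w ->
  cross (val x) (val y) (val z) (val w) != 0 ->
  (index (x, y) edges < index (z, w) edges)%N = (0 < cross (val x) (val y) (val z) (val w)).
Proof.
move=> xy zw; rewrite neq_lt => /orP[c_lt0|c_gt0]; last by rewrite c_gt0 index_edges.
rewrite [RHS]ltNge (ltW c_lt0) ltnNge ltnW // index_edges // crossC.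
by rewrite oppr_gt0.
Qed.

(** When a pair is about to be exchanged, the points before it are those on one side
    of its line and the points after it those on the other side. *)
Lemma sorted_upto_orient (e0 : P * P) k (x : P) : (k < size edges)%N ->
  let e := edge edges e0 k in
  sorted_upto lo edges k x e.1 = (orient (val e.1) (val e.2) (val x) < 0) /\
  sorted_upto lo edges k e.2 x = (0 < orient (val e.1) (val e.2) (val x)).
Proof.
move=> kN; rewrite /=; have ek : edge edges e0 k \in edges by rewrite mem_nth.
have ik : index (edge edges e0 k) edges = k by rewrite index_uniq ?edges_uniq.
case: (edge edges e0 k) ek ik => p q; rewrite mem_edges /= => pq ik.
have lo_asym (y z : P) : lo y z -> lo z y = false.
  by move=> yz; apply/negP => /(lex_trans yz); rewrite lex_irr.
have lo_irr (y : P) : lo y y = false by exact: lex_irr.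
have pNq := lo_neq pq.
have [->|xp] := eqVneq x p.
  by rewrite orient_l !ltxx /sorted_upto lo_irr (lo_asym _ _ pq) pq -ik ltnn.
have [->|xq] := eqVneq x q.
  by rewrite orient_r !ltxx /sorted_upto lo_irr (lo_asym _ _ pq) pq -ik ltnn.
set o := orient _ _ _; have o_neq0 : o != 0 by rewrite orient_neq0 // eq_sym.
have [c1 c2] : cross (val x) (val p) (val p) (val q) = o /\ cross (val p) (val x) (val p) (val
  q) = - o.
  by split; rewrite /o /orient /cross; ring.
have [c3 c4] : cross (val x) (val q) (val p) (val q) = o /\ cross (val q) (val x) (val p) (val
  q) = - o.
  by split; rewrite /o /orient /cross; ring.
rewrite /sorted_upto -ik; split.
  have /orP[xp'|px] := lo_total xp.
    by rewrite xp' leqNgt index_edges_lt // c1 // -leNgt lt_neqAle o_neq0.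
  by rewrite (lo_asym _ _ px) px index_edges_lt // c2 ?oppr_gt0 ?oppr_eq0.
have /orP[xq'|qx] := lo_total xq.
  by rewrite (lo_asym _ _ xq') xq' index_edges_lt // c3.
by rewrite qx leqNgt index_edges_lt // c4 ?oppr_gt0 ?oppr_eq0 // -leNgt lt_neqAle eq_sym o_neq0.
Qed.

(** The line contains one point of each colour and the excess of blue is 2d in all,
    so that the excess on one side determines the excess on the other. *)
Lemma balanced_line_through (p q : P) (S : {set P}) : p != q -> (p \in red) != (q \in red) ->
    S = [set x | orient (val p) (val q) (val x) < 0] \/ S = [set x | 0 < orient (val p) (val
      q) (val x)] ->
    #|S :\: red| = (d + #|S :&: red|)%N ->
  balanced B R (line_through (val p) (val q)).
Proof.
move=> pq pqR SE cardS.
have vpq : val p != val q by rewrite (inj_eq val_inj).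
pose S1 : {set P} := [set x | orient (val p) (val q) (val x) < 0].
pose S2 : {set P} := [set x | 0 < orient (val p) (val q) (val x)].
have cover (A : {set P}) : #|A| = (#|S1 :&: A| + #|S2 :&: A| + ((p \in A) + (q \in A)))%N.
  rewrite (cardsD1 p A) (cardsD1 q (A :\ p)) !inE eq_sym pq /=.
  have -> : #|A :\ p :\ q| = (#|S1 :&: A| + #|S2 :&: A|)%N.
    rewrite -(cardsID S1 (A :\ p :\ q)); congr (_ + _)%N; apply: eq_card => x; rewrite !inE.
      have [->|xp] := eqVneq x p; first by rewrite orient_l ltxx !andbF.
      have [->|xq] := eqVneq x q; first by rewrite orient_r ltxx !andbF.
      by rewrite andbC.
    have [->|xp] := eqVneq x p; first by rewrite orient_l ltxx !andbF.
    have [->|xq] := eqVneq x q; first by rewrite orient_r ltxx !andbF.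
    have := @orient_neq0 p q x; rewrite pq ![_ == x]eq_sym xp xq => /(_ isT isT isT).
    by case: ltgtP.
  by rewrite addnA addnC.
have [cR cB] := (cover red, cover (~: red)); rewrite !finset.in_setC in cB.
have cV : (#|red| + #|~: red| = (d + #|red|).*2)%N by rewrite cardsC card_points.
have good : #|S1 :\: red| = (d + #|S1 :&: red|)%N /\ #|S2 :\: red| = (d + #|S2 :&: red|)%N.
  move: cardS cR cB cV; rewrite !finset.setDE; case: SE => ->; rewrite -/S1 -/S2.
    by case: (p \in red) (q \in red) pqR => [] [] //=; lia.
  by case: (p \in red) (q \in red) pqR => [] [] //=; lia.
have onp : line_through (val p) (val q) (val p) by apply/line_throughE/orient_l.
have onq : line_through (val p) (val q) (val q) by apply/line_throughE/orient_r.
split; first exact: is_line_through.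
- have [pR|pR] := boolP (p \in red); last by exists (val p); rewrite ?in_blue.
  by exists (val q); rewrite // in_blue; move: pqR; rewrite pR; case: (q \in red).
- have [pR|pR] := boolP (p \in red); first by exists (val p); rewrite -?in_red.
  by exists (val q); rewrite // -in_red; move: pqR; rewrite (negbTE pR); case: (q \in red).
have [g1 g2] := good.
move=> h /(halfplane_orient vpq)[] hE.
  by rewrite (@count_in_blue S1) ?(@count_in_red S1) ?g1 => [|x|x]; rewrite ?inE ?hE //; lia.
by rewrite (@count_in_blue S2) ?(@count_in_red S2) ?g2 => [|x|x]; rewrite ?inE ?hE //; lia.
Qed.

Lemma line_through_inj (p q p' q' : P) : lo p q -> lo p' q' ->
  line_through (val p) (val q) = line_through (val p') (val q') -> (p, q) = (p', q').
Proof.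
move=> pq pq' E; have on (x : P) : line_through (val p') (val q') (val x) -> (x == p) || (x == q).
  rewrite -E => /line_throughE/eqP; apply: contraTT; rewrite negb_or => /andP[xp xq].
  by apply: orient_neq0; [exact: lo_neq | rewrite eq_sym | rewrite eq_sym].
have /orP[/eqP E1|/eqP E1] := on p' (iffRL (line_throughE _ _ _) (orient_l _ _));
have /orP[/eqP E2|/eqP E2] := on q' (iffRL (line_throughE _ _ _) (orient_r _ _)); subst=> //.
- by rewrite /lo lex_irr in pq'.
- by have := lex_trans pq pq'; rewrite lex_irr.
- by rewrite /lo lex_irr in pq'.
Qed.

Definition edge_line (e0 : P * P) (k : nat) : set (plane K) :=
  line_through (val (edge edges e0 k).1) (val (edge edges e0 k).2).

Lemma edges_neq0 : (0 < #|red|)%N -> (0 < size edges)%N.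
Proof.
move=> red_gt0; have : (1 < #|{: P}|)%N by rewrite card_points; lia.
move=> /card_gt1P[x [y [_ _ xy]]]; have /orP[] := lo_total xy; rewrite -mem_edges;
by case: edges.
Qed.

Lemma card_red_le_balanced (e0 : P * P) : (0 < #|red|)%N ->
  (#|red| <= #|[set k : 'I_(size edges) | `[< balanced B R (edge_line e0 k) >]]|)%N.
Proof.
move=> /edges_neq0; move sizeE: (size edges) => [//|n] _.
have := @twice_le_balanced_edges P lo edges e0 n.
have lo_irr : irreflexive lo by move=> y; apply: lex_irr.
have lo_trans : transitive lo by move=> y x z; apply: lex_trans.
move=> /(_ lo_irr lo_trans lo_total edges_uniq mem_edges sizeE edges_between red d card_points).
set F := [set _ | _]; set G := [set _ | _] => leF.
have FG : F \subset finset.setX [set: bool] G.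
  apply/fintype.subsetP => -[c k]; rewrite !finset.in_set /= -!in_red => /andP[eR /eqP cS].
  have kN : (k < size edges)%N by rewrite sizeE.
  have sideE (x : P) := sorted_upto_orient e0 x kN.
  apply/asboolP/(balanced_line_through _ eR _ cS).
    by apply: lo_neq; rewrite -mem_edges -surjective_pairing mem_nth.
  rewrite /beside; case: c {cS} => /=; [right|left]; apply/setP => x; rewrite !finset.in_set.
    exact: (sideE x).2.
  exact: (sideE x).1.
have := subset_leq_card FG; rewrite cardsX cardsT card_bool; lia.
Qed.

End Plane.

Local Open Scope classical_set_scope.

Theorem theorem1p1 (K : realType) (B R : {fset plane K})
    (disjBR : (B `&` R = fset0)%fset)
    (genpos : general_position (B `|` R)%fset)
    (leRB : (#|` R| <= #|` B|)%N)
    (evenBR : ~~ odd (#|` B| + #|` R|)) :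
  (`I_#|` R| #<= [set l : set (plane K) | balanced B R l])%card.
Proof.
have [R0|R_gt0] := posnP #|` R|; first by rewrite R0 II0; apply: card_ge0.
have red_gt0 : 0 < #|red B R| by rewrite card_red.
have edges_gt0 := edges_neq0 disjBR leRB evenBR red_gt0.
have [e0 _] : exists e0, e0 \in edges B R by case: (edges B R) edges_gt0 => // e ? _;
  exists e; apply: mem_head.
have := card_red_le_balanced disjBR genpos leRB evenBR e0 red_gt0.
rewrite card_red; set G := finset _ => leG.
have [k0] : exists k0, k0 \in G by apply/card_gt0P; apply: leq_trans leG.
move=> _; pose k i := nth k0 (enum G) i.
have kG i : i < #|` R| -> k i \in G.
  by move=> iR; rewrite -mem_enum mem_nth // -cardE (leq_trans iR).
apply/pcard_leP/injfunPex; exists (fun i => edge_line e0 (k i)) => [i /= iR|i j].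
  by have := kG i iR; rewrite finset.in_set => /asboolP.
rewrite !inE /= => iR jR E.
have loE (m : 'I_(size (edges B R))) : lo (edge (edges B R) e0 m).1 (edge (edges B R) e0 m).2.
  by rewrite -mem_edges -surjective_pairing mem_nth.
have := line_through_inj genpos (loE _) (loE _) E; rewrite -!surjective_pairing => /eqP.
rewrite nth_uniq ?edges_uniq // => /eqP/val_inj/eqP.
by rewrite nth_uniq ?enum_uniq -?cardE ?(leq_trans _ leG) // => /eqP.
Qed.
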